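(* Let $F=\frac1n\sum_{i=1}^nF_i$ be $\mu$-quasi-strongly monotone with $\mu>0$ and $\ell$-star-cocoercive. Assume that there is $\widehat\ell>0$ such that for all $x\in\mathbb{R}^d$, with $x^*=\mathrm{proj}_{X^*}(x)$, $$\frac1n\sum_{i=1}^n\|F_i(x)-F_i(x^* )\|^2\le\widehat\ell\,\langle F(x)-F(x^* ),x-x^*\rangle,$$ and that for all $i\in\{1,\dots,n\}$, $k\ge0$, $\mathbb{E}_k[g_i^k]=F_i(x^k)$ and $\mathbb{E}_k\|g_i^k-F_i(x^k)\|^2\le\sigma_i^2$. Let $$0<\gamma\le\frac{1}{3\ell+\frac{9\omega\widehat\ell}{n}}.$$ Then for all $k\ge0$ the iterates produced by QSGDA satisfy $$\mathbb{E}\|x^k-x^{*,k}\|^2\le(1-\gamma\mu)^k\|x^0-x^{*,0}\|^2+\gamma\,\frac{3(1+3\omega)\sigma^2+9\omega\zeta_*^2}{n\mu},$$ where $\sigma^2=\frac1n\sum_{i=1}^n\sigma_i^2$ and $\zeta_*^2=\frac1n\max_{x^*\in X^*}\sum_{i=1}^n\|F_i(x^* )\|^2$.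
   Context: Norms and inner products on $\mathbb{R}^d$ are Euclidean. $F,F_1,\dots,F_n:\mathbb{R}^d\to\mathbb{R}^d$ are operators and $R:\mathbb{R}^d\to\mathbb{R}\cup\{+\infty\}$ is a proper lower semicontinuous convex function. $X^*$ is the (nonempty) set of solutions of the regularized variational inequality: find $x^*\in\mathbb{R}^d$ with $\langle F(x^* ),x-x^*\rangle+R(x)-R(x^* )\ge0$ for all $x\in\mathbb{R}^d$. $\mathrm{proj}_{X^*}(x)=\arg\min_{y\in X^*}\|y-x\|$ (taken to be well defined), and $x^{*,k}=\mathrm{proj}_{X^*}(x^k)$. $\zeta_*^2$ is finite. For all $x\in\mathbb{R}^d$, with $x^*=\mathrm{proj}_{X^*}(x)$: $F$ is $\mu$-quasi-strongly monotone if $\langle F(x)-F(x^* ),x-x^*\rangle\ge\mu\|x-x^*\|^2$; $F$ is $\ell$-star-cocoercive ($\ell>0$) if $\|F(x)-F(x^* )\|^2\le\ell\langle F(x)-F(x^* ),x-x^*\rangle$. An unbiased compressor (quantization) with parameter $\omega\ge0$ is a possibly randomized map $\mathcal{Q}:\mathbb{R}^d\to\mathbb{R}^d$ with $\mathbb{E}[\mathcal{Q}(x)]=x$ and $\mathbb{E}\|\mathcal{Q}(x)-x\|^2\le\omega\|x\|^2$ for all $x$. QSGDA, with such a $\mathcal{Q}$ and deterministic $x^0$: at iteration $k$, each $i=1,\dots,n$ computes a stochastic estimate $g_i^k$ of $F_i(x^k)$ and $\mathcal{Q}(g_i^k)$; then $g^k=\frac1n\sum_{i=1}^n\mathcal{Q}(g_i^k)$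 and $x^{k+1}=\mathrm{prox}_{\gamma R}(x^k-\gamma g^k)$, where $\mathrm{prox}_{\gamma R}(x)=\arg\min_{y}\{R(y)+\|y-x\|^2/(2\gamma)\}$. Given the past, $g_1^k,\dots,g_n^k$ are independent, and given $g_1^k,\dots,g_n^k$, the vectors $\mathcal{Q}(g_1^k),\dots,\mathcal{Q}(g_n^k)$ are independent. $\mathbb{E}_k[\cdot]$ is the expectation with respect to the randomness at iteration $k$, i.e. conditional on everything generated before iteration $k$. *)

(* Defs.v *)
From HB Require Import structures.
From mathcomp Require Export all_boot all_order all_algebra.
From mathcomp Require Export all_classical all_reals all_analysis.
From mathcomp Require Export measurable_realfun.

Set Implicit Arguments.
Unset Strict Implicit.
Unset Printing Implicit Defensive.

Import Order.TTheory GRing.Theory Num.Theory.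
Import numFieldNormedType.Exports.

Local Open Scope classical_set_scope.
Local Open Scope ring_scope.

Section euclidean.
Context {R : realType} {d : nat}.
Implicit Types u v : 'rV[R]_d.

Definition dot u v : R := \sum_(j < d) u 0 j * v 0 j.

(* The norm that MathComp-Analysis puts on 'rV is the sup norm, so the
   Euclidean norm is defined separately; both induce the same topology. *)
Definition enorm u : R := Num.sqrt (dot u u).

End euclidean.

(* R^d with its Borel sigma-algebra. *)
Notation borelV R d := (g_sigma_algebraType (@open 'rV[R]_d)).

Definition argmin {T : Type} {disp} {U : porderType disp}
    (A : set T) (f : T -> U) : set T :=
  [set y | A y /\ forall z, A z -> (f y <= f z)%O].

Section variational_inequality.
Context {R : realType} {d : nat}.
Implicit Types (F : 'rV[R]_d -> 'rV[R]_d) (Reg : 'rV[R]_d -> \bar R)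
  (S : set 'rV[R]_d) (proj : 'rV[R]_d -> 'rV[R]_d) (x y : 'rV[R]_d).

Definition proper Reg :=
  (forall x, Reg x != -oo%E) /\ (exists x, Reg x != +oo%E).

Definition convex Reg := forall x y (t : R), 0 <= t <= 1 ->
  (Reg (t *: x + (1 - t) *: y)%R <= t%:E * Reg x + (1 - t)%:E * Reg y)%E.

(* When Reg is proper a solution xs has Reg xs finite: otherwise, since
   +oo - +oo = -oo in \bar R, the inequality fails at x = xs. *)
Definition vi_solutions F Reg : set 'rV[R]_d :=
  [set xs | forall x, (0 <= (dot (F xs) (x - xs))%:E + Reg x - Reg xs)%E].

(* The projection is well defined (existence and uniqueness of the minimizer)
   and proj is its value. *)
Definition is_projection S proj :=
  forall x, argmin S (fun y => enorm (y - x)) = [set proj x].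

Definition prox (gamma : R) Reg x : set 'rV[R]_d :=
  argmin setT
    (fun y => Reg y + (enorm (y - x) ^+ 2 / (2 * gamma))%:E)%E.

Definition quasi_strongly_monotone proj F (mu : R) := forall x,
  mu * enorm (x - proj x) ^+ 2 <= dot (F x - F (proj x)) (x - proj x).

Definition star_cocoercive proj F (l : R) := 0 < l /\ forall x,
  enorm (F x - F (proj x)) ^+ 2 <= l * dot (F x - F (proj x)) (x - proj x).

End variational_inequality.

Section averages.
Context {R : realType} {d n : nat}.

Definition mean_vec (u : 'I_n -> 'rV[R]_d) : 'rV[R]_d :=
  n%:R^-1 *: \sum_(i < n) u i.

Definition mean_op (F_ : 'I_n -> 'rV[R]_d -> 'rV[R]_d) (x : 'rV[R]_d) :=
  mean_vec (F_ ^~ x).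

Definition mean_sq (sigma : 'I_n -> R) : R :=
  n%:R^-1 * \sum_(i < n) sigma i ^+ 2.

Definition sq_norms_at (F_ : 'I_n -> 'rV[R]_d -> 'rV[R]_d)
    (S : set 'rV[R]_d) : set R :=
  [set \sum_(i < n) enorm (F_ i xs) ^+ 2 | xs in S].

Definition zeta_star_sq F_ (S : set 'rV[R]_d) : R :=
  n%:R^-1 * sup (sq_norms_at F_ S).

End averages.

(* A randomized map R^d -> R^d is a Markov kernel: Q x is the law of the
   random vector Q(x). *)
Definition unbiased_compressor {R : realType} {d : nat} (omega : R)
    (Q : R.-pker (borelV R d) ~> (borelV R d)) :=
  0 <= omega /\ forall x : 'rV[R]_d,
    (forall j : 'I_d,
       (Q x).-integrable setT (fun y : 'rV[R]_d => (y 0 j)%:E) /\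
       (\int[Q x]_y ((y : 'rV[R]_d) 0 j)%:E = (x 0 j)%:E)%E) /\
    (\int[Q x]_y (enorm ((y : 'rV[R]_d) - x) ^+ 2)%:E
       <= (omega * enorm x ^+ 2)%:E)%E.

Section conditioning.
Context {dO : measure_display} {Omega : measurableType dO} {R : realType}.
Variable P : probability Omega R.
Implicit Types G : set (set Omega).

Definition sub_sigma_algebra G :=
  sigma_algebra setT G /\ G `<=` measurable.

Definition measurable_wrt G {dU} {U : measurableType dU} (f : Omega -> U) :=
  forall B : set U, measurable B -> G (f @^-1` B).

(* Y is a version of the conditional expectation E[X | G]. *)
Definition is_cond_exp G (X Y : Omega -> \bar R) :=
  [/\ measurable_fun setT X,
      (forall w, 0 <= X w)%E \/ P.-integrable setT X,
      measurable_wrt G Y &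
      forall A, G A -> (\int[P]_(w in A) Y w = \int[P]_(w in A) X w)%E].

(* Y is a version of the conditional probability P(A | G). *)
Definition is_cond_prob G (A : set Omega) (Y : Omega -> \bar R) :=
  is_cond_exp G (fun w => (\1_A w)%:E) Y.

Definition cond_exp_le G (X : Omega -> \bar R) (c : R) :=
  exists2 Y, is_cond_exp G X Y & {ae P, forall w, (Y w <= c%:E)%E}.

(* Conditionally on G, the X_i are mutually independent. Subfamilies are
   obtained by taking B i = setT. *)
Definition cond_indep G {dU} {U : measurableType dU} {n : nat}
    (X : 'I_n -> Omega -> U) :=
  forall B : 'I_n -> set U, (forall i, measurable (B i)) ->
  exists2 p : 'I_n -> Omega -> R,
    forall i, is_cond_prob G (X i @^-1` B i) (EFin \o p i) &
    is_cond_prob G (\bigcap_i (X i @^-1` B i))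
      (fun w => (\prod_(i < n) p i w)%:E).

End conditioning.

Section qsgda.
Context {dO : measure_display} {Omega : measurableType dO} {R : realType}
  {d n : nat}.
Variables (P : probability Omega R)
  (Reg : 'rV[R]_d -> \bar R)
  (Q : R.-pker (borelV R d) ~> (borelV R d))
  (gamma : R) (x0 : 'rV[R]_d).

(* hist k is the sigma-algebra of everything generated before iteration k,
   g k i is g_i^k, and q k i is Q(g_i^k). *)
Variables (hist : nat -> set (set Omega))
  (x : nat -> Omega -> 'rV[R]_d)
  (g q : nat -> 'I_n -> Omega -> 'rV[R]_d).

Definition hist_est k : set (set Omega) :=
  <<s hist k `|`
      \bigcup_i preimage_set_system setT (g k i : Omega -> borelV R d)
                  measurable >>.

Record qsgda_run : Prop := {
  run_hist : forall k, sub_sigma_algebra (hist k);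
  run_hist_le : forall k, hist k `<=` hist k.+1;
  run_hist_x : forall k, measurable_wrt (hist k) (x k : Omega -> borelV R d);
  run_hist_g : forall k i,
    measurable_wrt (hist k.+1) (g k i : Omega -> borelV R d);
  run_hist_q : forall k i,
    measurable_wrt (hist k.+1) (q k i : Omega -> borelV R d);
  run_init : forall w, x 0%N w = x0;
  run_step : forall k w,
    prox gamma Reg (x k w - gamma *: mean_vec (fun i => q k i w))
      = [set x k.+1 w];
  run_g_indep : forall k,
    cond_indep P (hist k) (g k : 'I_n -> Omega -> borelV R d);
  (* q k i is obtained by applying the randomized map Q to g k i *)
  run_q_law : forall k i (B : set (borelV R d)), measurable B ->
    is_cond_prob P (hist_est k) (q k i @^-1` B) (fun w => Q (g k i w) B);
  run_q_indep : forall k,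
    cond_indep P (hist_est k) (q k : 'I_n -> Omega -> borelV R d)
}.

(* E_k[g_i^k] = F_i(x^k), coordinatewise *)
Definition unbiased_estimates (F_ : 'I_n -> 'rV[R]_d -> 'rV[R]_d) :=
  forall k i (j : 'I_d),
    is_cond_exp P (hist k) (fun w => (g k i w 0 j)%:E)
                           (fun w => (F_ i (x k w) 0 j)%:E).

Definition bounded_variance (F_ : 'I_n -> 'rV[R]_d -> 'rV[R]_d)
    (sigma : 'I_n -> R) :=
  forall k i,
    cond_exp_le P (hist k)
      (fun w => (enorm (g k i w - F_ i (x k w)) ^+ 2)%:E) (sigma i ^+ 2).

End qsgda.

(* Main.v *)
Require Import Defs.
From mathcomp Require Import ring lra.

Set Implicit Arguments.
Unset Strict Implicit.
Unset Printing Implicit Defensive.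

Import Order.TTheory GRing.Theory Num.Theory.
Import numFieldNormedType.Exports.

Local Open Scope classical_set_scope.
Local Open Scope ring_scope.

(** Since [- F xs] is a subgradient of [Reg] at [xs = proj x], the proximal step
    is a contraction towards [xs]: [|x' - xs|^2 <= |x - xs - gamma (g - F xs)|^2].
    Nothing makes [F_i (proj (x k))] measurable along the iterates, so this is
    never integrated as it stands.  Young's inequality first removes the product
    of the noise [g - F x] with [F x - F xs], and the cocoercivity assumptions
    absorb every term containing [F xs] into [<F x - F xs, x - xs>]; what remains
    is a pointwise recursion in measurable quantities (the projection onto a set
    with unique nearest points is continuous, by compactness).

    The noise splits into the compression errors [q i - g i] and the sampling
    errors [g i - F_i x].  These are pairwise orthogonal in L^2 by conditional
    independence, which gives the factor [1/n] in its variance. *)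

(** * Euclidean geometry and the proximal step *)

(** No moment of the iterates is assumed, and conditional expectations are given only through
    versions. So integrability of the squared distance to the solution set is carried along the
    induction: it is [x k - proj (x k)], not [x k], that is shown square integrable. And every
    conditional argument is reduced to one principle: an integrable [W] whose integral vanishes over
    each event of a sigma-algebra is orthogonal to every multiplier measurable for that
    sigma-algebra, as soon as the product is integrable.

    The variance of the noise retains [omega] times the mean of the [|F_i x|^2], which has to be
    absorbed before integrating. The descent inequality therefore carries their sum on its left
    side, with exactly the factor it has in the variance bound, and the two copies cancel after
    integration. *)

Section euclidean_theory.
Context {R : realType} {d : nat}.
Implicit Types u v w : 'rV[R]_d.

Lemma dotC u v : dot u v = dot v u.
Proof. by apply: eq_bigr => j _; rewrite mulrC. Qed.

Lemma dotDl u v w : dot (u + v) w = dot u w + dot v w.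
Proof. by rewrite -big_split; apply: eq_bigr => j _; rewrite mxE mulrDl. Qed.

Lemma dotZl (a : R) u v : dot (a *: u) v = a * dot u v.
Proof. by rewrite mulr_sumr; apply: eq_bigr => j _; rewrite mxE mulrA. Qed.

Lemma dotNl u v : dot (- u) v = - dot u v.
Proof. by rewrite -scaleN1r dotZl mulN1r. Qed.

Lemma dotDr u v w : dot w (u + v) = dot w u + dot w v.
Proof. by rewrite dotC dotDl !(dotC w). Qed.

Lemma dotZr (a : R) u v : dot v (a *: u) = a * dot v u.
Proof. by rewrite dotC dotZl dotC. Qed.

Lemma dotNr u v : dot v (- u) = - dot v u.
Proof. by rewrite dotC dotNl dotC. Qed.

Definition dotE := (dotDl, dotDr, dotNl, dotNr, dotZl, dotZr).

Lemma dot0l v : dot 0 v = 0.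
Proof. by rewrite -(scale0r v) dotZl mul0r. Qed.

Lemma dotvv_ge0 u : 0 <= dot u u.
Proof. by apply: sumr_ge0 => j _; rewrite -expr2 sqr_ge0. Qed.

Lemma sqr_enorm u : enorm u ^+ 2 = dot u u.
Proof. by rewrite sqr_sqrtr ?dotvv_ge0. Qed.

Lemma enorm_ge0 u : 0 <= enorm u.
Proof. exact: sqrtr_ge0. Qed.

Lemma enormE u : enorm u ^+ 2 = \sum_(j < d) u 0 j ^+ 2.
Proof. by rewrite sqr_enorm; apply: eq_bigr => j _; rewrite expr2. Qed.

Lemma sqr_coord_le u (j : 'I_d) : u 0 j ^+ 2 <= enorm u ^+ 2.
Proof.
rewrite enormE (bigD1 j)//= lerDl; apply: sumr_ge0 => i _; exact: sqr_ge0.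
Qed.

Lemma norm_coord_le u (j : 'I_d) : `|u 0 j| <= enorm u.
Proof.
by rewrite -(@ler_pXn2r _ 2) ?nnegrE ?enorm_ge0// real_normK ?num_real// sqr_coord_le.
Qed.

(** Cauchy-Schwarz: the squared norm of [dot v v *: u - dot u v *: v] is [dot v v] times the gap
    between the two sides. *)
Lemma dot_sqr_le u v : dot u v ^+ 2 <= dot u u * dot v v.
Proof.
have [v0|v0] := eqVneq (dot v v) 0.
  suff -> : dot u v = 0 by rewrite expr0n v0 mulr0.
  rewrite /dot big1// => j _.
  have := sqr_coord_le v j; rewrite sqr_enorm v0 => vj.
  suff -> : v 0 j = 0 by rewrite mulr0.
  by apply/eqP; rewrite -sqrf_eq0 eq_le vj sqr_ge0.
have vgt0 : 0 < dot v v by rewrite lt_def v0 dotvv_ge0.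
have := dotvv_ge0 (dot v v *: u - dot u v *: v).
rewrite !dotE (dotC v u).
set a := dot u u; set b := dot u v; set c := dot v v => h.
rewrite -subr_ge0 -(pmulr_rge0 _ vgt0).
by apply: le_trans h _; rewrite le_eqVlt; apply/orP; left; apply/eqP; rewrite -/c; ring.
Qed.

Lemma dot_le u v : dot u v <= enorm u * enorm v.
Proof.
rewrite /enorm -sqrtrM ?dotvv_ge0//.
apply: le_trans (ler_norm _) _.
by rewrite -sqrtr_sqr ler_wsqrtr// dot_sqr_le.
Qed.

Lemma enormD u v : enorm (u + v) <= enorm u + enorm v.
Proof.
rewrite -(@ler_pXn2r _ 2) ?nnegrE ?addr_ge0 ?enorm_ge0//.
rewrite sqrrD !sqr_enorm !dotE (dotC v u).
have := dot_le u v; lra.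
Qed.

Lemma enormN u : enorm (- u) = enorm u.
Proof. by rewrite /enorm dotNl dotNr opprK. Qed.

Lemma enorm_distC u v : enorm (u - v) = enorm (v - u).
Proof. by rewrite -opprB enormN. Qed.

Lemma enorm_distD v u w : enorm (u - w) <= enorm (u - v) + enorm (v - w).
Proof. by rewrite -{1}(subrK v u) -addrA enormD. Qed.

Lemma enorm0_eq0 u : enorm u <= 0 -> u = 0.
Proof.
move=> u0; apply/rowP => j; rewrite mxE; apply/eqP.
by rewrite -normr_le0 (le_trans (norm_coord_le _ _)).
Qed.

Lemma enorm_le_mx_norm u : enorm u <= Num.sqrt d%:R * `|u|.
Proof.
rewrite -(@ler_pXn2r _ 2) ?nnegrE ?mulr_ge0 ?enorm_ge0 ?sqrtr_ge0//.
rewrite enormE exprMn sqr_sqrtr ?ler0n//.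
apply: (@le_trans _ _ (\sum_(j < d) `|u| ^+ 2)).
  apply: ler_sum => j _; rewrite -(@real_normK _ (u 0 j)) ?num_real//.
  rewrite ler_pXn2r ?nnegrE// [leRHS]/Num.norm/= mx_normrE.
  by apply/bigmax_geP; right => /=; exists (0, j).
by rewrite sumr_const card_ord -[leLHS]mulr_natl.
Qed.

Lemma mx_norm_le_enorm u : `|u| <= enorm u.
Proof.
rewrite [leLHS]/Num.norm/= mx_normrE; apply/bigmax_leP; split => [|[i j] _ /=].
  exact: enorm_ge0.
by rewrite ord1 norm_coord_le.
Qed.

End euclidean_theory.

Section proximal_step.
Context {R : realType} {d : nat}.
Implicit Types (Reg : 'rV[R]_d -> \bar R) (x y z p : 'rV[R]_d).

Lemma vi_solution_fin F Reg xs : proper Reg -> vi_solutions F Reg xs ->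
  Reg xs \is a fin_num.
Proof.
move=> [Reg_Ny [y Regy]] /(_ xs); have := Reg_Ny xs.
by case: (Reg xs) => [r| |]//=; rewrite ?addeNy.
Qed.

Lemma le0_of_le_mul (A B : R) :
  (forall t, 0 < t <= 1 -> A <= t * B) -> A <= 0.
Proof.
move=> AB; rewrite leNgt; apply/negP => A0.
have B1 : A <= B by rewrite -[B]mul1r AB// ltr01 lexx.
have B0 : 0 < B by exact: lt_le_trans B1.
(* At this [t] the bound [t * B] is only half of [A]. *)
have /AB : 0 < A / (2 * B) <= 1.
  by rewrite divr_gt0 ?mulr_gt0//= ler_pdivrMr ?mulr_gt0//; lra.
have -> : A / (2 * B) * B = A / 2 by field; rewrite gt_eqF.
lra.
Qed.

(* The subgradient inequality at the proximal point comes from comparing p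
   with p + t (y - p) and letting t tend to 0. *)
Lemma prox_variational Reg gamma z p y (r s : R) :
  0 < gamma -> proper Reg -> convex Reg -> prox gamma Reg z p ->
  Reg p = r%:E -> Reg y = s%:E -> gamma * (r - s) <= dot (p - z) (y - p).
Proof.
move=> gamma0 [Reg_Ny _] cReg [_ pmin] Rp Ry; rewrite -subr_le0.
(* The second-order term [t ^+ 2 * dot (y - p) (y - p)] of the expanded square, divided by [2 * t],
   leaves this multiple of [t]. *)
apply: (@le0_of_le_mul _ (dot (y - p) (y - p) / 2)) => t /andP[t0 t1].
have := cReg y p t; rewrite ltW//= t1 => /(_ isT).
rewrite Rp Ry -!EFinM -EFinD.
have := pmin (t *: y + (1 - t) *: p) I; rewrite Rp.
have := Reg_Ny (t *: y + (1 - t) *: p).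
case: (Reg _) => [m| |]//= _; rewrite -!EFinD !lee_fin.
have -> : t *: y + (1 - t) *: p - z = (p - z) + t *: (y - p).
  by apply/rowP => j; rewrite !mxE; ring.
rewrite !sqr_enorm !dotE (dotC y p) (dotC z p) (dotC z y).
set pp := dot p p; set yy := dot y y; set py := dot p y; set pz := dot p z.
set zz := dot z z; set yz := dot y z.
move=> h1 h2; have {h2}h1 := le_trans h1 (lerD h2 (lexx _)).
have g2 : 0 < 2 * gamma by rewrite mulr_gt0.
have := ler_wpM2l (ltW g2) h1.
rewrite !mulrDr ![_ * (_ / _)]mulrC !divfK ?gt_eqF// => h.
rewrite -(ler_pM2l t0).
nra.
Qed.

(** With [w = x - gamma *: g + gamma *: F xs], adding [gamma] times the variational inequality at
    [p] to the proximal inequality at [xs] cancels the values of [Reg] and leaves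
    [0 <= dot (w - p) (p - xs)]. Hence [p - xs] is no longer than its sum with [w - p], which is
    [w - xs]. *)
Lemma prox_contract F Reg gamma x g p xs :
  0 < gamma -> proper Reg -> convex Reg -> vi_solutions F Reg xs ->
  prox gamma Reg (x - gamma *: g) p ->
  enorm (p - xs) ^+ 2 <= enorm (x - xs - gamma *: (g - F xs)) ^+ 2.
Proof.
move=> gamma0 prReg cReg xsol pprox.
have xsfin := vi_solution_fin prReg xsol.
have [s Rxs] : exists s, Reg xs = s%:E by exists (fine (Reg xs)); rewrite fineK.
have [r Rp] : exists r, Reg p = r%:E.
  move: (proj1 prReg p) (proj2 pprox xs I).
  case: (Reg p) => [r| |]//= _; first by exists r.
  by rewrite Rxs addye// leye_eq.
have := prox_variational gamma0 prReg cReg pprox Rp Rxs.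
have := xsol p; rewrite Rp Rxs -!EFinD lee_fin.
move=> /(ler_wpM2l (ltW gamma0)); rewrite mulr0.
set w := x - gamma *: g + gamma *: F xs => h1 h2.
have h : 0 <= dot (w - p) (p - xs).
  have -> : w - p = gamma *: F xs - (p - (x - gamma *: g)).
    by apply/rowP => j; rewrite !mxE; ring.
  rewrite dotDl dotZl dotNl; move: h2; rewrite -(opprB p xs) dotNr; lra.
have -> : x - xs - gamma *: (g - F xs) = (w - p) + (p - xs).
  by apply/rowP => j; rewrite !mxE; ring.
move: h; generalize (w - p) (p - xs) => a b ab.
rewrite !sqr_enorm dotDl !dotDr (dotC b a).
have := dotvv_ge0 a; lra.
Qed.

End proximal_step.

(** * Projection onto a set with unique nearest points *)

Section projection.
Context {R : realType} {d : nat}.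
Variables (S : set 'rV[R]_d) (proj : 'rV[R]_d -> 'rV[R]_d).
Hypothesis projP : is_projection S proj.

Lemma projS x : S (proj x).
Proof. by have : [set proj x] (proj x) by []; rewrite -projP => -[]. Qed.

Lemma proj_min x y : S y -> enorm (proj x - x) <= enorm (y - x).
Proof.
by move=> Sy; have : [set proj x] (proj x) by []; rewrite -projP => -[_]; exact.
Qed.

Lemma proj_uniq x y : S y -> enorm (y - x) <= enorm (proj x - x) -> y = proj x.
Proof.
move=> Sy yx; suff : [set proj x] y by [].
rewrite -projP; split=> // z Sz; exact: le_trans yx (proj_min _ Sz).
Qed.

Lemma nbhs_enorm (x : 'rV[R]_d) (e : R) : 0 < e ->
  nbhs x [set y | enorm (y - x) <= e].
Proof.
(* The [+ 1] keeps [K] positive when [d = 0]. *)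
move=> e0; set K : R := Num.sqrt d%:R + 1.
have K0 : 0 < K by rewrite ltr_wpDl ?sqrtr_ge0.
have : nbhs x (ball x (e / K)) by apply: nbhsx_ballx; rewrite divr_gt0.
apply: filterS => y; rewrite -ball_normE /= => xy.
rewrite enorm_distC; apply: le_trans (enorm_le_mx_norm _) _.
move: (ltW xy); rewrite ler_pdivlMr// mulrC; apply: le_trans.
by rewrite ler_wpM2r// lerDl.
Qed.

Lemma continuous_enorm (c : 'rV[R]_d) :
  continuous (fun y : 'rV[R]_d => enorm (y - c)).
Proof.
move=> y; apply/(@cvgrPdist_le _ _ _ _ (nbhs_filter y)) => e e0.
apply: filterS (nbhs_enorm y e0) => z /= zy.
have := enorm_distD y z c; have := enorm_distD z y c.
rewrite (enorm_distC y z) ler_distl; lra.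
Qed.

(** Points of [S] come arbitrarily near a point of the closure, so its nearest point is at distance
    0. *)
Lemma closed_proj : closed S.
Proof.
move=> x clSx; suff -> : x = proj x by exact: projS.
apply/eqP; rewrite eq_sym -subr_eq0; apply/eqP/enorm0_eq0.
apply/ler_addgt0Pr => e e0; rewrite add0r.
have /clSx[y [Sy]] := nbhs_enorm x e0.
by move=> /= yx; exact: le_trans (proj_min _ Sy) yx.
Qed.

(* On the points of S near x but at distance at least e from proj x, the
   distance to x has a minimum, which exceeds the distance from x to S. *)
Lemma continuous_proj : continuous proj.
Proof.
move=> x; apply/(@cvgrPdist_lt _ _ _ _ (nbhs_filter x)) => e e0.
set D := enorm (proj x - x).
pose K := S `&` [set y | enorm (y - x) <= D + 1]
            `&` [set y | e <= enorm (y - proj x)].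
have [m m0 mK] : exists2 m, 0 < m & forall y, K y -> D + m <= enorm (y - x).
  have [K0|/set0P K0] := eqVneq K set0.
    by exists 1 => // y; rewrite K0.
  have cK : compact K.
    apply: bounded_closed_compact.
      exists (D + 1 + enorm x); split; first exact: num_real.
      move=> M /ltW DM y [[_ /= yx] _]; apply: le_trans DM.
      apply: le_trans (mx_norm_le_enorm _) _.
      by rewrite -(subrK x y) (le_trans (enormD _ _))// lerD2r.
    apply: closedI; first apply: closedI.
    - exact: closed_proj.
    - apply: (@closed_comp _ _ (fun y : 'rV[R]_d => enorm (y - x)) [set t | t <= D + 1]).
        by move=> y _; exact: continuous_enorm.
      exact: closed_le.
    - apply: (@closed_comp _ _ (fun y : 'rV[R]_d => enorm (y - proj x)) [set t | e <= t]).
        by move=> y _; exact: continuous_enorm.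
      exact: closed_ge.
  have [|c /set_mem Kc cmin] := EVT_min_rV (f := fun y : 'rV[R]_d => enorm (y - x)) K0 cK.
    by apply: continuous_subspaceT; exact: continuous_enorm.
  exists (enorm (c - x) - D); last first.
    by move=> y Ky; rewrite addrCA subrr addr0 cmin//; exact/mem_set.
  rewrite subr_gt0 ltNge; apply/negP => cD.
  have [[Sc _] /=] := Kc.
  by rewrite (proj_uniq Sc cD) subrr /enorm dot0l sqrtr0 leNgt e0.
(* For [z] within [r] of [x], [proj z] is within [D + 2 * r] of [x]. The bound [r <= 1 / 3] keeps it
   in the ball of radius [D + 1] that makes [K] compact; [3 * r <= m] puts it below the minimum
   [D + m] over [K]. *)
set r := Num.min m 1 / 3.
have r0 : 0 < r by rewrite divr_gt0// lt_min m0 ltr01.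
have rm : r * 3 <= m by rewrite divfK ?pnatr_eq0// ge_min lexx.
have r1 : r * 3 <= 1 by rewrite divfK ?pnatr_eq0// ge_min lexx orbT.
apply: filterS (nbhs_enorm x r0) => z /= zx.
have h1 : enorm (proj z - x) <= D + 2 * r.
  have := enorm_distD z (proj z) x.
  have := proj_min z (projS x).
  have := enorm_distD x (proj x) z; rewrite (enorm_distC x z) -/D.
  lra.
apply: le_lt_trans (mx_norm_le_enorm _) _; rewrite enorm_distC ltNge.
apply/negP => h2.
have /mK : K (proj z) by split=> //; split; [exact: projS|rewrite /=; lra].
lra.
Qed.

End projection.

(** * The pointwise recursion *)

Section descent.
Context {R : realType} {d n : nat}.
Variables (F_ : 'I_n -> 'rV[R]_d -> 'rV[R]_d) (Reg : 'rV[R]_d -> \bar R)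
  (proj : 'rV[R]_d -> 'rV[R]_d) (mu l lhat omega gamma : R).
Local Notation F := (mean_op F_).
Local Notation Xstar := (vi_solutions F Reg).
Local Notation inner x := (dot (F x - F (proj x)) (x - proj x)).
Local Notation zeta2 := (zeta_star_sq F_ Xstar).
Hypotheses (n_gt0 : (0 < n)%N) (Reg_proper : proper Reg) (Reg_convex : convex Reg)
  (projP : is_projection Xstar proj)
  (zeta_finite : has_ubound (sq_norms_at F_ Xstar))
  (mu_gt0 : 0 < mu) (omega_ge0 : 0 <= omega)
  (F_qsm : quasi_strongly_monotone proj F mu)
  (F_coco : star_cocoercive proj F l)
  (lhat_gt0 : 0 < lhat)
  (F_lhat : forall x,
     n%:R^-1 * (\sum_(i < n) enorm (F_ i x - F_ i (proj x)) ^+ 2)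
     <= lhat * inner x)
  (gamma_gt0 : 0 < gamma)
  (gamma_le : gamma <= 1 / (3 * l + 9 * omega * lhat / n%:R)).

Let nR_gt0 : 0 < n%:R :> R. Proof. by rewrite ltr0n. Qed.

Lemma inner_ge0 x : 0 <= inner x.
Proof.
by apply: le_trans (F_qsm x); rewrite mulr_ge0 ?sqr_ge0// ltW.
Qed.

(** Cauchy-Schwarz bounds the square of the inner product [H] by [G * A], and cocoercivity bounds
    [G] by [l * H]; one factor [H] cancels. *)
Lemma inner_le x : inner x <= l * enorm (x - proj x) ^+ 2.
Proof.
have [l0 coco] := F_coco.
have := dot_sqr_le (F x - F (proj x)) (x - proj x).
have := coco x; have := inner_ge0 x; rewrite !sqr_enorm.
have := dotvv_ge0 (x - proj x).
set H := inner x; set A := dot (x - proj x) _; set G := dot (F x - _) (F x - _).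
rewrite le_eqVlt => A0 H0 GH HG.
have {A0}A0 : 0 <= A by case/orP: A0 => [/eqP <-|/ltW].
move: H0; rewrite le_eqVlt => /orP[/eqP <-|H0]; first by rewrite mulr_ge0// ltW.
rewrite -(ler_pM2l H0) -expr2 (le_trans HG)// mulrCA mulrA ler_wpM2r//.
Qed.

(** Split [F_ i x] around [F_ i (proj x)], at the cost of a factor 2: [lhat] controls the
    differences, and [zeta2] the rest because [proj x] is a solution. *)
Lemma sum_sqr_le_inner x :
  \sum_(i < n) enorm (F_ i x) ^+ 2 <= 2 * n%:R * (lhat * inner x + zeta2).
Proof.
have le2 (u v : 'rV[R]_d) : enorm u ^+ 2 <= 2 * enorm (u - v) ^+ 2 + 2 * enorm v ^+ 2.
  rewrite -{1}(subrK v u); move: (u - v) => w.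
  have := dotvv_ge0 (w - v).
  by rewrite !sqr_enorm !dotE (dotC v w); lra.
apply: (@le_trans _ _ (2 * \sum_(i < n) enorm (F_ i x - F_ i (proj x)) ^+ 2
                       + 2 * \sum_(i < n) enorm (F_ i (proj x)) ^+ 2)).
  by rewrite !mulr_sumr -big_split; apply: ler_sum => i _; exact: le2.
rewrite -mulrA -mulrDr ler_pM2l ?ltr0n// mulrDr lerD//.
  by have := F_lhat x; rewrite ler_pdivrMl.
rewrite /zeta_star_sq mulrA mulfV ?gt_eqF// mul1r.
apply: ub_le_sup => //; exists (proj x) => //; exact: (projS projP).
Qed.

Lemma zeta_star_sq_ge0 : 0 <= zeta2.
Proof.
apply: mulr_ge0; first by rewrite invr_ge0 ltW.
apply: (@le_trans _ _ (\sum_(i < n) enorm (F_ i (proj 0)) ^+ 2)).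
  by apply: sumr_ge0 => i _; exact: sqr_ge0.
by apply: ub_le_sup => //; exists (proj 0) => //; exact: (projS projP).
Qed.

(** Serves integrability: the right side is affine in the squared distance, whose integrability is
    known by induction. *)
Lemma sum_sqr_le_dist x : \sum_(i < n) enorm (F_ i x) ^+ 2
  <= 2 * n%:R * (lhat * (l * enorm (x - proj x) ^+ 2) + zeta2).
Proof.
apply: le_trans (sum_sqr_le_inner x) _.
by rewrite ler_pM2l ?mulr_gt0 ?ltr0n// lerD2r ler_pM2l// inner_le.
Qed.

Lemma step_le1 : gamma * (3 * l + 9 * omega * lhat / n%:R) <= 1.
Proof.
have [l0 _] := F_coco.
rewrite -ler_pdivlMr// ltr_wpDr ?mulr_gt0//.
by rewrite divr_ge0 ?mulr_ge0// ?ler0n// ltW.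
Qed.

(* mu <= l unless every point is a solution. *)
Lemma contraction_ge0 x : x != proj x -> 0 <= 1 - gamma * mu.
Proof.
move=> xp; have [l0 _] := F_coco.
have D0 : 0 < enorm (x - proj x) ^+ 2.
  rewrite exprn_gt0// lt_def enorm_ge0 andbT; apply: contra xp => /eqP D0.
  by rewrite -subr_eq0; apply/eqP/enorm0_eq0; rewrite D0.
have mul : mu <= l.
  by rewrite -(ler_pM2r D0); apply: le_trans (F_qsm x) (inner_le x).
have := step_le1; rewrite mulrDr.
have : 0 <= gamma * (9 * omega * lhat / n%:R).
  by rewrite mulr_ge0 ?divr_ge0 ?mulr_ge0// ?ler0n// ltW.
have := ler_wpM2l (ltW gamma_gt0) mul.
have := mulr_gt0 gamma_gt0 l0.
lra.
Qed.

(* Young's inequality splits the mixed product of the noise ghat - F x with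
   F x - F (proj x); the latter need not be measurable along the iterates. *)
Lemma descent_step x ghat p : prox gamma Reg (x - gamma *: ghat) p ->
  enorm (p - proj p) ^+ 2
  + 2 * gamma ^+ 2 * omega / n%:R ^+ 2 * \sum_(i < n) enorm (F_ i x) ^+ 2
  <= (1 - gamma * mu) * enorm (x - proj x) ^+ 2
     + 4 * gamma ^+ 2 * omega * zeta2 / n%:R
     - 2 * gamma * dot (x - proj x) (ghat - F x)
     + 2 * gamma ^+ 2 * enorm (ghat - F x) ^+ 2.
Proof.
move=> pprox; have [l0 coco] := F_coco.
have xsol := projS projP x.
have pxs : enorm (p - proj p) ^+ 2 <= enorm (p - proj x) ^+ 2.
  rewrite ler_pXn2r ?nnegrE ?enorm_ge0// ![enorm (p - _)]enorm_distC.
  exact: (proj_min projP).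
have := prox_contract gamma_gt0 Reg_proper Reg_convex xsol pprox.
have -> : x - proj x - gamma *: (ghat - F (proj x))
        = (x - proj x) - gamma *: ((ghat - F x) + (F x - F (proj x))).
  by apply/rowP => j; rewrite !mxE; ring.
move: (enorm (p - proj x) ^+ 2) (enorm (p - proj p) ^+ 2) pxs => P D DP.
move: (F_qsm x) (coco x) (sum_sqr_le_inner x) step_le1.
rewrite (dotC (F x - F (proj x))).
move: (x - proj x) (ghat - F x) (F x - F (proj x)) => a e b.
(* Young's inequality with unit weights, [2 <e, b> <= |e|^2 + |b|^2]: the origin of the factor 2 in
   front of the squared noise. *)
have := dotvv_ge0 (e - b).
rewrite !sqr_enorm !dotE (dotC b a) (dotC e a) (dotC b e).
set A := dot a a; set H := dot a b; set B := dot b b; set E := dot e e.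
set X := dot a e; set EB := dot e b; set S := \sum_(i < n) _.
move=> eb qsm cc Sle stp Ple.
set N : R := n%:R.
have c0 : 0 <= 2 * gamma ^+ 2 * omega / N ^+ 2.
  by rewrite divr_ge0 ?sqr_ge0// mulr_ge0// mulr_ge0 ?sqr_ge0.
have {Sle}Sle := ler_wpM2l c0 Sle.
(* The step-size budget: multiplying [gamma ^+ 2 * H], this term costs [4 * omega * lhat / N] and
   the doubled [B] costs [2 * l]. As [gamma] times their sum is at most 1, half of [- 2 * gamma * H]
   survives, and quasi-strong monotonicity turns it into [- gamma * mu * A]. *)
have e1 : 2 * gamma ^+ 2 * omega / N ^+ 2 * (2 * N * (lhat * H + zeta2))
  = gamma * H * (gamma * (4 * omega * lhat / N)) + 4 * gamma ^+ 2 * omega * zeta2 / N.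
  by field; rewrite gt_eqF.
rewrite e1 in Sle.
have H0 : 0 <= H by apply: le_trans qsm; rewrite mulr_ge0 ?dotvv_ge0// ltW.
have gH : 0 <= gamma * H by rewrite mulr_ge0// ltW.
have g2 : 0 <= gamma ^+ 2 by exact: sqr_ge0.
have k1 := ler_wpM2l g2 eb; have k2 := ler_wpM2l g2 cc.
have k3 := ler_wpM2l gH stp.
have k4 := ler_wpM2l (ltW gamma_gt0) qsm.
have oN : 0 <= omega * lhat / N by rewrite divr_ge0 ?mulr_ge0// ?ltW.
have k5 : 0 <= gamma * H * (gamma * (omega * lhat / N)).
  exact: mulr_ge0 gH (mulr_ge0 (ltW gamma_gt0) oN).
have k6 : 0 <= gamma * H * (gamma * l).
  exact: mulr_ge0 gH (mulr_ge0 (ltW gamma_gt0) (ltW l0)).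
move: Sle k1 k2 k3 k4 k5 k6.
move: (4 * gamma ^+ 2 * omega * zeta2 / N) (2 * gamma ^+ 2 * omega / N ^+ 2 * S) => Z T.
rewrite -!mulrA; move: (omega * (lhat / N)) => W.
rewrite /=; lra.
Qed.

End descent.

(** * Integration of products and compositions *)

Section nonneg_functionals.
Local Open Scope ereal_scope.
Context {d : measure_display} {U : measurableType d} {R : realType}.
Implicit Types (I : (U -> \bar R) -> \bar R) (f : U -> \bar R).

Definition nnmeasurable f := measurable_fun setT f /\ forall x, 0 <= f x.

(** The properties by which the values on indicators determine all others. Plain integrals,
    integrals with a density and integrals iterated through a kernel share them, so identities
    between these need checking on sets only. *)
Definition integral_like I :=
  [/\ I (cst 0) = 0,
      forall f g, nnmeasurable f -> nnmeasurable g -> I (f \+ g) = I f + I g,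
      forall (k : R) f, (0 <= k)%R -> nnmeasurable f ->
        I (fun x => k%:E * f x) = k%:E * I f &
      forall f_ : nat -> U -> \bar R, (forall n, nnmeasurable (f_ n)) ->
        (forall x, nondecreasing_seq (f_ ^~ x)) ->
        I (fun x => limn (f_ ^~ x)) = limn (I \o f_)].

Import HBNNSimple.

(** Simple functions are finite combinations of indicators, and [f] is an increasing limit of simple
    functions. The coefficients must be kept nonnegative, being values of a nonnegative function,
    since homogeneity is available for [0 <= k] only. *)
Lemma eq_integral_like I1 I2 f : integral_like I1 -> integral_like I2 ->
  (forall B, measurable B -> I1 (EFin \o \1_B) = I2 (EFin \o \1_B)) ->
  nnmeasurable f -> I1 f = I2 f.
Proof.
move=> [I10 I1D I1Z I1lim] [I20 I2D I2Z I2lim] I12 [mf f0].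
have I12s (h : {nnsfun U >-> R}) : I1 (EFin \o h) = I2 (EFin \o h).
  have -> : EFin \o h = (fun x => \sum_(r <- finmap.enum_fset (fset_set (range h)))
              r%:E * (EFin \o \1_(h @^-1` [set r])) x).
    apply/funext => x /=; rewrite fimfunE fsbig_finite//= -sumEFin.
    by apply: eq_bigr => r _; rewrite EFinM.
  set s : seq R := finmap.enum_fset (fset_set (range h)).
  have : forall r, r \in s -> (0 <= r)%R.
    have sE r : (r \in s) = (r \in range h) by exact: in_fset_set.
    by move=> r; rewrite sE inE => -[x _ <-]; exact: fun_ge0.
  elim: s => [_|r s ih rs].
    rewrite (_ : (fun x => _) = cst 0) ?I10 ?I20//.
    by apply/funext => x; rewrite big_nil.
  have nnB (k : R) : nnmeasurable (EFin \o \1_(h @^-1` [set k])).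
    split; last by move=> x; rewrite lee_fin.
    exact/measurable_EFinP/measurable_indic.
  have nnZ (k : R) : (0 <= k)%R ->
      nnmeasurable (fun x => k%:E * (EFin \o \1_(h @^-1` [set k])) x).
    move=> k0; split; last by move=> x; rewrite mule_ge0// lee_fin.
    by apply: measurable_funeM; have [] := nnB k.
  have ss k : k \in s -> (0 <= k)%R by move=> ks; rewrite rs// inE ks orbT.
  have nnS : nnmeasurable (fun x =>
      \sum_(k <- s) k%:E * (EFin \o \1_(h @^-1` [set k])) x).
    split.
      apply: emeasurable_sum => k.
      by apply: measurable_funeM; have [] := nnB k.
    move=> x; rewrite big_seq; apply: sume_ge0 => k /ss k0.
    by have [_] := nnZ k k0; exact.
  have -> : (fun x => \sum_(k <- r :: s) k%:E * (EFin \o \1_(h @^-1` [set k])) x)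
     = (fun x => r%:E * (EFin \o \1_(h @^-1` [set r])) x) \+
       (fun x => \sum_(k <- s) k%:E * (EFin \o \1_(h @^-1` [set k])) x).
    by apply/funext => x; rewrite big_cons.
  have r0 : (0 <= r)%R by rewrite rs// mem_head.
  rewrite I1D ?I2D//; [|exact: nnZ|exact: nnZ].
  by rewrite I1Z// I2Z// I12// ih.
pose f_ := nnsfun_approx measurableT mf.
have -> : f = (fun x => limn (fun n => (EFin \o f_ n) x)).
  by apply/funext => x; apply/esym/cvg_lim => //; exact: cvg_nnsfun_approx.
have nnf n : nnmeasurable (EFin \o f_ n).
  by split; [exact/measurable_EFinP|move=> x; rewrite lee_fin].
have ndf x : nondecreasing_seq (fun n => (EFin \o f_ n) x).
  by move=> m n mn; rewrite lee_fin; exact/lefP/nd_nnsfun_approx.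
rewrite (I1lim (fun n => EFin \o f_ n))// (I2lim (fun n => EFin \o f_ n))//.
by congr (limn _); apply/funext => n /=; exact: I12s.
Qed.

Lemma integral_like_integral (m : {measure set U -> \bar R}) (D : set U) :
  measurable D -> integral_like (fun f => \int[m]_(x in D) f x).
Proof.
move=> mD; have mf f : nnmeasurable f -> measurable_fun D f.
  by move=> [mf _]; exact: measurable_funTS.
split.
- by rewrite integral0.
- move=> f g nnf nng; have [_ f0] := nnf; have [_ g0] := nng.
  by rewrite ge0_integralD//; exact: mf.
- by move=> k f k0 nnf; have [_ f0] := nnf; rewrite ge0_integralZl_EFin//; exact: mf.
- move=> f_ nnf nd; rewrite monotone_convergence//.
  + by move=> n; exact: mf.
  + by move=> n x _; have [_] := nnf n; exact.
Qed.

End nonneg_functionals.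

Section nonneg_functionals_composition.
Local Open Scope ereal_scope.
Context {d1 d2 : measure_display} {T : measurableType d1}
  {U : measurableType d2} {R : realType}.

Lemma nnmeasurable_comp (h : T -> U) (f : U -> \bar R) :
  measurable_fun setT h -> nnmeasurable f -> nnmeasurable (f \o h).
Proof. by move=> mh [mf f0]; split=> [|w]; [exact: measurableT_comp|exact: f0]. Qed.

(** The density [V] will be the positive or negative part of a signed one, or the indicator of an
    event. *)
Lemma integral_like_density (m : {measure set T -> \bar R}) (h : T -> U)
    (V : T -> R) : measurable_fun setT h -> measurable_fun setT V ->
  (forall w, (0 <= V w)%R) ->
  integral_like (fun f => \int[m]_w (f (h w) * (V w)%:E)).
Proof.
move=> mh mV V0; have {}mV : measurable_fun setT (EFin \o V).
  exact/measurable_EFinP.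
have [I0 ID IZ Ilim] := integral_like_integral m measurableT.
have nnV f : nnmeasurable f -> nnmeasurable (fun w => f (h w) * (V w)%:E).
  move=> nnf; have [mf f0] := nnmeasurable_comp mh nnf.
  by split=> [|w]; [exact: emeasurable_funM|rewrite mule_ge0 ?f0// lee_fin].
split.
- by rewrite -[RHS]I0; apply: eq_integral => w _; rewrite mul0e.
- move=> f g nnf nng; rewrite -ID; [|exact: nnV|exact: nnV].
  apply: eq_integral => w _ /=; rewrite ge0_muleDl//.
  + by have [_] := nnf; exact.
  + by have [_] := nng; exact.
- move=> k f k0 nnf; rewrite -IZ//; last exact: nnV.
  by apply: eq_integral => w _; rewrite muleA.
- move=> f_ nnf nd.
  rewrite -(Ilim (fun n w => f_ n (h w) * (V w)%:E)).
  + apply: eq_integral => w _.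
    by rewrite [RHS]limeMr//; exact: ereal_nondecreasing_is_cvgn.
  + by move=> n; exact: nnV.
  + by move=> w i j ij; apply: lee_wpmul2r; [rewrite lee_fin|exact: nd].
Qed.

(** Measurability is asked of [K] event by event, because for [w |-> Q (g w)] it is obtained in that
    form, from the conditional law of [q]. *)
Lemma integral_like_kernel (m : {measure set T -> \bar R}) (D : set T)
    (K : T -> {measure set U -> \bar R}) : measurable D ->
  (forall B, measurable B -> measurable_fun setT (K ^~ B)) ->
  integral_like (fun f => \int[m]_(w in D) \int[K w]_y f y).
Proof.
move=> mD mK; have [I0 ID IZ Ilim] := integral_like_integral m mD.
have Kl w := integral_like_integral (K w) measurableT.
have nnK f : nnmeasurable f -> nnmeasurable (fun w => \int[K w]_y f y).
  move=> [mf f0]; split=> [|w]; last exact: integral_ge0.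
  exact: measurable_fun_integral_kernel.
split.
- by rewrite -[RHS]I0; apply: eq_integral => w _; have [->] := Kl w.
- move=> f g nnf nng; rewrite -ID; [|exact: nnK|exact: nnK].
  by apply: eq_integral => w _ /=; have [_ ->] := Kl w.
- move=> k f k0 nnf; rewrite -IZ//; last exact: nnK.
  by apply: eq_integral => w _; have [_ _ ->] := Kl w.
- move=> f_ nnf nd.
  rewrite -(Ilim (fun n w => \int[K w]_y f_ n y)).
  + by apply: eq_integral => w _; have [_ _ _ ->] := Kl w.
  + by move=> n; exact: nnK.
  + move=> w i j ij; apply: ge0_le_integral => //.
    * by move=> y _; have [_] := nnf i; exact.
    * by have [] := nnf i.
    * by have [] := nnf j.
    * by move=> y _; exact: nd.
Qed.

End nonneg_functionals_composition.

(** * Integrable and square-integrable real functions *)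

Section integrable_real.
Context {dO : measure_display} {Omega : measurableType dO} {R : realType}.
Variable P : {measure set Omega -> \bar R}.
Implicit Types f g : Omega -> R.

Definition L1 f := P.-integrable setT (EFin \o f).

Lemma L1_measurable f : L1 f -> measurable_fun setT f.
Proof. by move=> /integrableP[/measurable_EFinP]. Qed.

Lemma L1_le f g : measurable_fun setT f -> (forall w, `|f w| <= g w) ->
  L1 g -> L1 f.
Proof.
move=> mf fg; apply: le_integrable => //; first exact/measurable_EFinP.
move=> w _ /=; rewrite lee_fin; exact: le_trans (fg w) (ler_norm _).
Qed.

Lemma L1D f g : L1 f -> L1 g -> L1 (fun w => f w + g w).
Proof. by move=> f1 g1; exact: (integrableD measurableT f1 g1). Qed.

Lemma L1B f g : L1 f -> L1 g -> L1 (fun w => f w - g w).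
Proof. by move=> f1 g1; exact: (integrableB measurableT f1 g1). Qed.

Lemma L1Z (a : R) f : L1 f -> L1 (fun w => a * f w).
Proof. by move=> f1; exact: (integrableZl measurableT a f1). Qed.

Lemma L1_sum (I : Type) (s : seq I) (h : I -> Omega -> R) :
  (forall i, L1 (h i)) -> L1 (fun w => \sum_(i <- s) h i w).
Proof.
move=> h1; elim: s => [|i s ih].
  by under eq_fun do rewrite big_nil; exact: integrable0.
by under eq_fun do rewrite big_cons; exact: L1D.
Qed.

Lemma Rintegral_sum (I : Type) (s : seq I) (h : I -> Omega -> R) :
  (forall i, L1 (h i)) ->
  \int[P]_w \sum_(i <- s) h i w = \sum_(i <- s) \int[P]_w h i w.
Proof.
move=> h1; elim: s => [|i s ih].
  under eq_Rintegral do rewrite big_nil.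
  by rewrite big_nil Rintegral_cst// mul0r.
under eq_Rintegral do rewrite big_cons.
by rewrite big_cons RintegralD ?ih//; [exact: h1|exact: L1_sum].
Qed.

Lemma integral_EFin f : L1 f -> (\int[P]_w (f w)%:E)%E = (\int[P]_w f w)%:E.
Proof. by move=> f1; rewrite fineK//; exact: integrable_fin_num. Qed.

End integrable_real.

Section square_integrable.
Context {dO : measure_display} {Omega : measurableType dO} {R : realType}.
Variable P : probability Omega R.
Implicit Types f g : Omega -> R.
Local Notation L1 := (L1 P).

Lemma L1_cst (a : R) : L1 (fun=> a).
Proof. exact: finite_measure_integrable_cst. Qed.

Definition L2 f := measurable_fun setT f /\ L1 (fun w => f w ^+ 2).

Lemma L2_le f g : measurable_fun setT f -> (forall w, f w ^+ 2 <= g w) ->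
  L1 g -> L2 f.
Proof.
move=> mf fg g1; split=> //; apply: L1_le g1 => [|w].
  exact: measurable_funX.
by rewrite ger0_norm ?sqr_ge0.
Qed.

Lemma L2_mul f g : L2 f -> L2 g -> L1 (fun w => f w * g w).
Proof.
move=> [mf f2] [mg g2]; apply: L1_le (L1D f2 g2) => [|w].
  exact: measurable_funM.
rewrite normrM -(real_normK (num_real (f w))) -(real_normK (num_real (g w))).
have := sqr_ge0 (`|f w| - `|g w|); have := mulr_ge0 (normr_ge0 (f w)) (normr_ge0 (g w)).
rewrite sqrrB; lra.
Qed.

Lemma L2_cst (a : R) : L2 (fun=> a).
Proof. by split=> //; exact: L1_cst. Qed.

Lemma L2_L1 f : L2 f -> L1 f.
Proof.
move=> f2; have := L2_mul f2 (L2_cst 1).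
by under eq_fun do rewrite mulr1.
Qed.

Lemma L2D f g : L2 f -> L2 g -> L2 (fun w => f w + g w).
Proof.
move=> [mf f2] [mg g2].
apply: L2_le (L1Z 2 (L1D f2 g2)) => [|w]; first exact: measurable_funD.
have := sqr_ge0 (f w - g w); rewrite sqrrB sqrrD; lra.
Qed.

Lemma L2Z (a : R) f : L2 f -> L2 (fun w => a * f w).
Proof.
move=> [mf f2]; apply: L2_le (L1Z (a ^+ 2) f2) => [|w].
  exact: measurable_funM.
by rewrite exprMn.
Qed.

Lemma L2B f g : L2 f -> L2 g -> L2 (fun w => f w - g w).
Proof.
move=> f2 g2; have := L2D f2 (L2Z (-1) g2).
by under eq_fun do rewrite mulN1r.
Qed.

Lemma L2_sum (I : Type) (s : seq I) (h : I -> Omega -> R) :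
  (forall i, L2 (h i)) -> L2 (fun w => \sum_(i <- s) h i w).
Proof.
move=> h1; elim: s => [|i s ih].
  by under eq_fun do rewrite big_nil; exact: L2_cst.
by under eq_fun do rewrite big_cons; exact: L2D.
Qed.

Lemma Rintegral_sqr_sum (n : nat) (h : 'I_n -> Omega -> R) :
  (forall i, L2 (h i)) ->
  (forall i j, i != j -> \int[P]_w (h i w * h j w) = 0) ->
  \int[P]_w ((\sum_(i < n) h i w) ^+ 2) = \sum_(i < n) \int[P]_w (h i w ^+ 2).
Proof.
move=> h2 h0.
under eq_Rintegral do rewrite expr2 mulr_suml.
rewrite Rintegral_sum => [|i]; last by apply: L2_mul => //; exact: L2_sum.
apply: eq_bigr => i _.
under eq_Rintegral do rewrite mulr_sumr.
rewrite Rintegral_sum => [|j]; last exact: L2_mul.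
rewrite (bigD1 i)//= big1 ?addr0// => j ji.
by rewrite h0// eq_sym.
Qed.

Lemma Rintegral_sqrD f g : L2 f -> L2 g -> \int[P]_w (f w * g w) = 0 ->
  \int[P]_w ((f w + g w) ^+ 2)
  = \int[P]_w (f w ^+ 2) + \int[P]_w (g w ^+ 2).
Proof.
move=> f2 g2 fg0.
have -> : \int[P]_w ((f w + g w) ^+ 2) =
    \int[P]_w (f w ^+ 2 + (g w ^+ 2 + 2 * (f w * g w))).
  by apply: eq_Rintegral => w _; rewrite sqrrD; ring.
have fg1 := L2_mul f2 g2; have [_ f1] := f2; have [_ g1] := g2.
rewrite RintegralD//; last exact: L1D g1 (L1Z 2 fg1).
by rewrite RintegralD//; [rewrite RintegralZl// fg0 mulr0 addr0|exact: L1Z].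
Qed.

End square_integrable.

Section orthogonality.
Context {dO dU : measure_display} {Omega : measurableType dO}
  {U : measurableType dU} {R : realType}.
Variable P : probability Omega R.

(** The measures with densities [W^\+] and [W^\-] have the same image under [h], hence give the same
    integral to every nonnegative function of [h]. Splitting [phi] as well yields four products,
    each dominated by [|phi (h w) * W w|], so only that product has to be integrable. *)
Lemma Rintegral_comp_mul_eq0 (h : Omega -> U) (W : Omega -> R) (phi : U -> R) :
  measurable_fun setT h -> L1 P W ->
  (forall B, measurable B -> \int[P]_(w in h @^-1` B) W w = 0) ->
  measurable_fun setT phi -> L1 P (fun w => phi (h w) * W w) ->
  \int[P]_w (phi (h w) * W w) = 0.
Proof.
move=> mh W1 hW mphi pW1; have mW := L1_measurable W1.
have part f : (forall w : U, (0 <= f w)%E) -> measurable_fun setT f ->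
   (\int[P]_w (f (h w) * (W^\+ w)%:E) = \int[P]_w (f (h w) * (W^\- w)%:E))%E.
  move=> f0 mf.
  apply: (@eq_integral_like _ U R (fun f => \int[P]_w (f (h w) * (W^\+ w)%:E))%E
                (fun f => \int[P]_w (f (h w) * (W^\- w)%:E))%E f) => //.
  - by apply: integral_like_density => //; exact: measurable_funrpos.
  - by apply: integral_like_density => //; exact: measurable_funrneg.
  move=> B mB; have mhB : measurable (h @^-1` B) by rewrite -[_ @^-1` _]setTI; exact: mh.
  have indE (V : Omega -> R) : (\int[P]_w ((EFin \o \1_B) (h w) * (V w)%:E) =
      \int[P]_(w in h @^-1` B) (V w)%:E)%E.
    rewrite [RHS]integral_mkcond epatch_indic; apply: eq_integral => w _ /=.
    by rewrite muleC.
  rewrite !indE.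
  have Wp := integrableS measurableT mhB (@subsetT _ _) (integrable_funrpos measurableT W1).
  have Wn := integrableS measurableT mhB (@subsetT _ _) (integrable_funrneg measurableT W1).
  have := hW B mB; rewrite -[X in Rintegral _ _ X]funrposBneg.
  rewrite RintegralB//; move/eqP; rewrite subr_eq0 => /eqP e.
  rewrite -[LHS]fineK; last exact: integrable_fin_num.
  rewrite -[RHS]fineK; last exact: integrable_fin_num.
  by congr EFin.
have mp := measurable_funrpos mphi; have mn := measurable_funrneg mphi.
have mWp := measurable_funrpos mW; have mWn := measurable_funrneg mW.
have bnd (a : U -> R) (b : Omega -> R) : measurable_fun setT a -> measurable_fun setT b ->
    (forall u, 0 <= a u <= `|phi u|) -> (forall w, 0 <= b w <= `|W w|) ->
    L1 P (fun w => a (h w) * b w).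
  move=> ma mb ha hb.
  apply: (@L1_le _ _ _ _ _ (fun w => `|phi (h w) * W w|)) => [|w|].
  - by apply: measurable_funM => //; exact: measurableT_comp.
  - have /andP[a0 ap] := ha (h w); have /andP[b0 bw] := hb w.
    by rewrite ger0_norm ?mulr_ge0// normrM ler_pM.
  - exact: integrable_norm.
have bp T (f : T -> R) t : 0 <= f^\+ t <= `|f t|.
  by rewrite /funrpos le_max lexx orbT/= ge_max ler_norm normr_ge0.
have bn T (f : T -> R) t : 0 <= f^\- t <= `|f t|.
  by rewrite /funrneg le_max lexx orbT/= ge_max ler_normr lexx orbT normr_ge0.
have Rpart (f : U -> R) : (forall u, 0 <= f u) -> measurable_fun setT f ->
    \int[P]_w (f (h w) * W^\+ w) = \int[P]_w (f (h w) * W^\- w).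
  move=> f0 mf; have := part (EFin \o f); rewrite /Rintegral => -> //.
  exact/measurable_EFinP.
have pp := bnd _ _ mp mWp (bp _ _) (bp _ _).
have pn := bnd _ _ mp mWn (bp _ _) (bn _ _).
have np := bnd _ _ mn mWp (bn _ _) (bp _ _).
have nn := bnd _ _ mn mWn (bn _ _) (bn _ _).
transitivity (\int[P]_w ((phi^\+ (h w) * W^\+ w - phi^\+ (h w) * W^\- w)
                     - (phi^\- (h w) * W^\+ w - phi^\- (h w) * W^\- w))).
  apply: eq_Rintegral => w _.
  rewrite -{1}(funrposBneg phi) -{1}(funrposBneg W) /=.
  by rewrite mulrBl !mulrBr.
rewrite RintegralB//; [|exact: L1B|exact: L1B].
have p0 u : 0 <= phi^\+ u by have /andP[] := bp _ phi u.
have n0 u : 0 <= phi^\- u by have /andP[] := bn _ phi u.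
by rewrite !RintegralB// (Rpart _ p0)// (Rpart _ n0)// !subrr.
Qed.

End orthogonality.

(** * Conditional probability and conditional independence *)

Section sub_sigma_algebras.
Context {dO : measure_display} {Omega : measurableType dO} {R : realType}.
Variables (P : probability Omega R) (G : set (set Omega)).
Hypothesis hG : sub_sigma_algebra G.

Local Notation TG := (g_sigma_algebraType G).

Lemma sub_sigma_measurableE : (measurable : set (set TG)) = G.
Proof. exact: (sigma_algebra_id (proj1 hG)). Qed.

Lemma sub_sigma_measurable (B : set Omega) : G B -> measurable B.
Proof. exact: (proj2 hG). Qed.

Lemma sub_sigma_setT : G setT.
Proof. by rewrite -sub_sigma_measurableE; exact: measurableT. Qed.

Lemma measurable_wrtP {dU} {U : measurableType dU} (f : Omega -> U) :
  measurable_wrt G f <-> measurable_fun [set: TG] (f : TG -> U).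
Proof.
split=> [mf _ B mB|mf B mB].
  by rewrite setTI sub_sigma_measurableE; exact: mf.
by rewrite -sub_sigma_measurableE -[_ @^-1` _]setTI; exact: mf.
Qed.

Lemma measurable_wrt_measurable {dU} {U : measurableType dU} (f : Omega -> U) :
  measurable_wrt G f -> measurable_fun setT f.
Proof. by move=> mf _ B mB; rewrite setTI; apply: sub_sigma_measurable; exact: mf. Qed.

Lemma measurable_id_sub_sigma : measurable_fun [set: Omega] (id : Omega -> TG).
Proof.
by move=> _ B; rewrite sub_sigma_measurableE setTI; exact: sub_sigma_measurable.
Qed.

(** Take for [h] the identity, seen as a random variable with values in [Omega] equipped with [G].
    This plays the part of the pull-out and tower rules of conditional expectation. *)
Lemma Rintegral_sub_sigma_eq0 (W phi : Omega -> R) :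
  L1 P W -> (forall A, G A -> \int[P]_(w in A) W w = 0) ->
  measurable_wrt G phi -> L1 P (fun w => phi w * W w) ->
  \int[P]_w (phi w * W w) = 0.
Proof.
move=> W1 hW mphi pW.
apply: (@Rintegral_comp_mul_eq0 _ _ _ TG _ P id W phi) => //.
- exact: measurable_id_sub_sigma.
- by move=> B; rewrite sub_sigma_measurableE => GB; exact: hW.
- exact/measurable_wrtP.
Qed.

(* Integrate W over the event where it is negative. *)
Lemma ae_ge0_sub_sigma (W : Omega -> R) :
  measurable_wrt G W -> (forall A, G A -> (0 <= \int[P]_(w in A) (W w)%:E)%E) ->
  {ae P, forall w, 0 <= W w}.
Proof.
move=> GW hW; have mW := measurable_wrt_measurable GW.
pose N := W @^-1` [set r | r < 0].
have GN : G N by apply: GW; rewrite -set_itvNyo; exact: measurable_itv.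
have mN := sub_sigma_measurable GN.
have mWN : measurable_fun N (EFin \o W).
  by apply: measurable_funTS; exact/measurable_EFinP.
have /ae_eq_integral_abs : (\int[P]_(w in N) `|(EFin \o W) w| = 0)%E.
  apply/eqP; rewrite eq_le integral_ge0 ?andbT//.
  rewrite (eq_integral (fun w => (- (EFin \o W) w)%E)); last first.
    by move=> w; rewrite inE => Ww /=; rewrite (ltr0_norm (Ww : W w < 0)).
  have := hW _ GN; have := @integral_ge0N _ _ _ P N (fun w => (- (EFin \o W) w)%E).
  under eq_integral do rewrite oppeK.
  move=> ->; first by rewrite leeNr oppe0.
  by move=> w Nw; rewrite oppe_ge0 lee_fin ltW.
move=> /(_ mN mWN); apply: filterS => w WN; rewrite leNgt; apply/negP => Ww.
by have := WN Ww => -[] W0; rewrite W0 ltxx in Ww.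
Qed.

Lemma Rintegral_indicM (A : set Omega) (W : Omega -> R) : measurable A ->
  \int[P]_(w in A) W w = \int[P]_w (\1_A w * W w).
Proof.
move=> mA; rewrite Rintegral_mkcond patch_indic.
by apply: eq_Rintegral => w _ /=; rewrite mulrC.
Qed.

Lemma L1_indic (A : set Omega) : measurable A -> L1 P \1_A.
Proof. by move=> mA; exact: integrable_indic. Qed.

Lemma L1_bounded_mul (b W : Omega -> R) : measurable_fun setT b ->
  (forall w, 0 <= b w <= 1) -> L1 P W -> L1 P (fun w => b w * W w).
Proof.
move=> mb b01 W1.
apply: (@L1_le _ _ _ _ _ (fun w => `|W w|)) => [|w|].
- by apply: measurable_funM => //; exact: L1_measurable W1.
- have /andP[b0 b1] := b01 w.
  by rewrite normrM (ger0_norm b0) ler_piMl.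
- exact: integrable_norm.
Qed.

Lemma integral_cond_prob (E A : set Omega) (p : Omega -> R) :
  measurable E -> is_cond_prob P G E (EFin \o p) -> G A ->
  (\int[P]_(w in A) (p w)%:E = P (E `&` A))%E.
Proof.
move=> mE [_ _ _ hp] GA; rewrite hp// integral_indic//.
exact: sub_sigma_measurable.
Qed.

Lemma cond_prob_measurable_wrt (E : set Omega) (p : Omega -> R) :
  is_cond_prob P G E (EFin \o p) -> measurable_wrt G p.
Proof.
by move=> [_ _ /measurable_wrtP mp _]; apply/measurable_wrtP/measurable_EFinP.
Qed.

(** Being a version does not include integrability. The integrals of [p] over events of [G] are
    probabilities, so [p] is nonnegative almost surely; then [|p|] has total integral [P E]. *)
Lemma cond_prob_L1 (E : set Omega) (p : Omega -> R) :
  measurable E -> is_cond_prob P G E (EFin \o p) ->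
  L1 P p /\ {ae P, forall w, 0 <= p w}.
Proof.
move=> mE cp; have Gp := cond_prob_measurable_wrt cp.
have mp := measurable_wrt_measurable Gp.
have p0 : {ae P, forall w, 0 <= p w}.
  by apply: ae_ge0_sub_sigma => // A GA; rewrite (integral_cond_prob mE cp).
split=> //; apply/integrableP; split; first exact/measurable_EFinP.
rewrite (ae_eq_integral (EFin \o p)).
- by rewrite (integral_cond_prob mE cp sub_sigma_setT) setIT (le_lt_trans (probability_le1 _ _))// ltry.
- by [].
- by apply: measurableT_comp => //; exact/measurable_EFinP.
- exact/measurable_EFinP.
- by apply: filterS p0 => w pw _ /=; rewrite ger0_norm.
Qed.

Lemma measurable_wrtB (f g : Omega -> R) :
  measurable_wrt G f -> measurable_wrt G g -> measurable_wrt G (fun w => f w - g w).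
Proof.
move=> /measurable_wrtP mf /measurable_wrtP mg; apply/measurable_wrtP.
exact: measurable_funB.
Qed.

Lemma measurable_wrt_cst (a : R) : measurable_wrt G (fun=> a).
Proof. exact/measurable_wrtP/measurable_cst. Qed.

Lemma integral_sub_cst (A : set Omega) (p : Omega -> R) (a : R) :
  measurable A -> L1 P p ->
  (\int[P]_(w in A) (p w - a)%:E = \int[P]_(w in A) (p w)%:E - a%:E * P A)%E.
Proof.
move=> mA p1; rewrite integralB_EFin//.
- by rewrite integral_cst.
- exact: integrableS p1.
- by apply: integrableS (L1_cst _ _).
Qed.

Lemma cond_prob_le1 (E : set Omega) (p : Omega -> R) :
  measurable E -> is_cond_prob P G E (EFin \o p) -> {ae P, forall w, p w <= 1}.
Proof.
move=> mE cp; have Gp := cond_prob_measurable_wrt cp.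
have [p1 _] := cond_prob_L1 mE cp.
have : {ae P, forall w, 0 <= 1 - p w}.
  apply: ae_ge0_sub_sigma => [|A GA].
    exact: measurable_wrtB (measurable_wrt_cst 1) Gp.
  have mA := sub_sigma_measurable GA.
  rewrite integralB_EFin//.
  - rewrite integral_cst// mul1e (integral_cond_prob mE cp)// sube_ge0.
      by apply: le_measure; rewrite ?inE//; exact: measurableI.
    by apply/orP; right; exact: fin_num_measure.
  - by apply: integrableS (L1_cst _ _).
  - exact: integrableS p1.
by apply: filterS => w; rewrite subr_ge0.
Qed.

(** Removes from the product in [cond_indep] the factors of the unconstrained indices. *)
Lemma cond_prob_setT (p : Omega -> R) :
  is_cond_prob P G setT (EFin \o p) -> {ae P, forall w, p w = 1}.
Proof.
move=> cp; have Gp := cond_prob_measurable_wrt cp.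
have [p1 _] := cond_prob_L1 measurableT cp.
have := cond_prob_le1 measurableT cp.
have : {ae P, forall w, 0 <= p w - 1}.
  apply: ae_ge0_sub_sigma => [|A GA].
    exact: measurable_wrtB Gp (measurable_wrt_cst 1).
  have mA := sub_sigma_measurable GA.
  rewrite integral_sub_cst// (integral_cond_prob measurableT cp)// setTI mul1e.
  by rewrite subee// fin_num_measure.
by apply: filterS2 => w; rewrite subr_ge0 => h1 h2; apply/le_anti/andP.
Qed.

(* p itself takes values in [0, 1] only almost surely. *)
Lemma cond_prob_clip (E : set Omega) (p : Omega -> R) :
  measurable E -> is_cond_prob P G E (EFin \o p) ->
  exists c : Omega -> R, [/\ measurable_wrt G c, forall w, 0 <= c w <= 1,
    {ae P, forall w, p w = c w} &
    forall A, G A -> \int[P]_(w in A) (\1_E w - c w) = 0].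
Proof.
move=> mE cp; have Gp := cond_prob_measurable_wrt cp.
have [p1 p0] := cond_prob_L1 mE cp; have ple1 := cond_prob_le1 mE cp.
pose c w := Num.max 0 (Num.min 1 (p w)).
have c01 w : 0 <= c w <= 1 by rewrite /c le_max lexx/= ge_max ler01 ge_min lexx.
have Gc : measurable_wrt G c.
  apply/measurable_wrtP; apply: measurable_maxr => //; apply: measurable_minr => //.
  exact/measurable_wrtP.
have pc : {ae P, forall w, p w = c w}.
  apply: filterS2 p0 ple1 => w w0 w1.
  by rewrite /c (min_r w1) (max_r w0).
exists c; split=> // A GA; have mA := sub_sigma_measurable GA.
have mc := measurable_wrt_measurable Gc.
have c1 : L1 P c.
  apply: L1_le (L1_cst P 1) => // w.
  by have /andP[h0 h1] := c01 w; rewrite ger0_norm.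
rewrite RintegralB//; [|by apply: integrableS (L1_indic _)|exact: integrableS c1].
apply/eqP; rewrite subr_eq0; apply/eqP; congr fine.
have [_ _ _ hp] := cp; rewrite -hp//.
apply: ae_eq_integral => //.
- by apply: measurable_funTS; apply/measurable_EFinP; exact: measurable_wrt_measurable.
- by apply: measurable_funTS; exact/measurable_EFinP.
- by apply: filterS pc => w pw _ /=; rewrite pw.
Qed.

End sub_sigma_algebras.

Section conditional_independence.
Context {dO dU : measure_display} {Omega : measurableType dO}
  {U : measurableType dU} {R : realType} {n : nat}.
Variables (P : probability Omega R) (G : set (set Omega)).
Hypothesis hG : sub_sigma_algebra G.
Variable X : 'I_n -> Omega -> U.
Hypothesis mX : forall i, measurable_fun setT (X i).
Hypothesis indX : cond_indep P G X.

Let mpre i B : measurable B -> measurable (X i @^-1` B).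
Proof. by move=> mB; rewrite -[_ @^-1` _]setTI; exact: mX. Qed.

(** All other indices receive the event [setT]. Clipping makes the versions bounded, so that all
    later products are integrable; of the product formula only its integral over the whole space is
    kept. *)
Lemma cond_indep_pair (i j : 'I_n) (B C : set U) : i != j ->
  measurable B -> measurable C ->
  exists b c : Omega -> R,
    [/\ measurable_wrt G b, forall w, 0 <= b w <= 1 &
        forall A, G A -> \int[P]_(w in A) (\1_(X i @^-1` B) w - b w) = 0] /\
    [/\ measurable_wrt G c, forall w, 0 <= c w <= 1,
        forall A, G A -> \int[P]_(w in A) (\1_(X j @^-1` C) w - c w) = 0 &
        \int[P]_w (b w * c w)
        = \int[P]_w (\1_(X i @^-1` B) w * \1_(X j @^-1` C) w)].
Proof.
move=> ij mB mC.
pose D l := if l == i then B else if l == j then C else setT.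
have mD l : measurable (D l) by rewrite /D; case: ifP => // _; case: ifP.
have [p hp hprod] := indX mD.
have Di : D i = B by rewrite /D eqxx.
have Dj : D j = C by rewrite /D eq_sym (negbTE ij) eqxx.
have := hp i; rewrite Di => /(cond_prob_clip hG (mpre i mB)) [b [Gb b01 pb hb]].
have := hp j; rewrite Dj => /(cond_prob_clip hG (mpre j mC)) [c [Gc c01 pc hc]].
exists b, c; split; split=> //.
have mb := measurable_wrt_measurable hG Gb.
have mc := measurable_wrt_measurable hG Gc.
have capE : \bigcap_l X l @^-1` D l = X i @^-1` B `&` X j @^-1` C.
  apply/seteqP; split=> [w Dw|w [Bw Cw] l _ /=].
    by split; [have := Dw i I; rewrite /= Di|have := Dw j I; rewrite /= Dj].
  by rewrite /D; case: eqVneq => [->//|_]; case: eqVneq => [->//|].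
have mcap : measurable (\bigcap_l X l @^-1` D l).
  by rewrite capE; apply: measurableI; exact: mpre.
have := integral_cond_prob hG mcap hprod (sub_sigma_setT hG).
have pl l : {ae P, forall w, l != i -> l != j -> p l w = 1}.
  have [->|li] := eqVneq l i; first by apply: aeW => w; rewrite ?eqxx.
  have [->|lj] := eqVneq l j; first by apply: aeW => w _; rewrite ?eqxx.
  have := hp l; rewrite /D (negbTE li) (negbTE lj) preimage_setT.
  by move=> /(cond_prob_setT hG); apply: filterS.
have prodE : {ae P, forall w, \prod_(l < n) p l w = b w * c w}.
  have all : {ae P, forall w, forall l, l != i -> l != j -> p l w = 1}.
    exact: filter_forall.
  have pbc : {ae P, forall w, p i w = b w /\ p j w = c w}.
    by apply: filterS2 pb pc.
  apply: filterS2 all pbc => w h [pi pj].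
  rewrite (bigD1 i)//= (bigD1 j)/=; last by rewrite eq_sym.
  by rewrite big1 ?mulr1 ?pi ?pj// => l /andP[li lj]; exact: h.
have mprod := measurable_wrt_measurable hG (cond_prob_measurable_wrt hG hprod).
have mbc : measurable_fun setT (fun w => b w * c w) by exact: measurable_funM.
rewrite (ae_eq_integral (EFin \o (fun w => b w * c w)))//; last 3 first.
- exact/measurable_EFinP.
- exact/measurable_EFinP.
- by apply: filterS prodE => w e _ /=; rewrite e.
rewrite /Rintegral => ->; congr fine.
rewrite setIT capE -[in LHS](setIT (_ `&` _)) -integral_indic//; last first.
  by apply: measurableI; exact: mpre.
by apply: eq_integral => w _; rewrite indicI.
Qed.

(* It suffices that h (X j) - Z integrates to 0 over every event X i \in B.
   There 1_B (X i) may be replaced by a version b of P(X i \in B | G): against Z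
   because Z is G-measurable, and against h (X j) by conditional independence.
   As cond_indep provides different versions b for different events of X j, the
   latter is first checked on the indicators of the events X j \in C. *)
Lemma cond_indep_orthogonal (i j : 'I_n) (f h : U -> R) (Y Z : Omega -> R) :
  i != j -> measurable_fun setT f -> measurable_fun setT h ->
  L2 P (f \o X i) -> L2 P (h \o X j) -> L2 P Y -> L2 P Z ->
  measurable_wrt G Y -> measurable_wrt G Z ->
  (forall A, G A -> \int[P]_(w in A) (h (X j w) - Z w) = 0) ->
  \int[P]_w ((f (X i w) - Y w) * (h (X j w) - Z w)) = 0.
Proof.
move=> ij mf mh f2 h2 Y2 Z2 GY GZ hZ.
have hZ2 : L2 P (fun w => h (X j w) - Z w) by exact: L2B h2 Z2.
have hZ1 := L2_L1 hZ2; have Z1 := L2_L1 Z2; have h1 := L2_L1 h2.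
have key B : measurable B ->
    \int[P]_(w in X i @^-1` B) (h (X j w) - Z w) = 0.
  move=> mB; have mXB := mpre i mB; rewrite Rintegral_indicM//.
  set e := X i @^-1` B.
  (* The choice [setT] for [X j] is a placeholder: only a version [b] for the event of [X i] is
     wanted here. *)
  have [b [_ [[Gb b01 hb] _]]] := cond_indep_pair ij mB measurableT.
  have mb := measurable_wrt_measurable hG Gb.
  have me : measurable_fun setT (\1_e : Omega -> R) by exact: measurable_indic.
  have e01 w : 0 <= (\1_e w : R) <= 1.
    by rewrite indicE ler0n lern1; case: (_ \in _).
  have eb V : L1 P V -> L1 P (fun w => V w * (\1_e w - b w)).
    move=> V1; have := L1B (L1_bounded_mul me e01 V1) (L1_bounded_mul mb b01 V1).
    by under eq_fun do rewrite -mulrBl mulrC.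
  have eb1 : L1 P (fun w => \1_e w - b w).
    by have := eb _ (L1_cst P 1); under eq_fun do rewrite mul1r.
  have ebZ := Rintegral_sub_sigma_eq0 hG eb1 hb GZ (eb _ Z1).
  have bh1 := L1_bounded_mul mb b01 hZ1.
  have bhZ := Rintegral_sub_sigma_eq0 hG hZ1 hZ Gb bh1.
  have ebh : \int[P]_w (h (X j w) * (\1_e w - b w)) = 0.
    apply: (@Rintegral_comp_mul_eq0 _ _ _ _ _ P (X j) (fun w => \1_e w - b w) h) => //; last exact: eb.
    move=> C mC; have mXC := mpre j mC; rewrite Rintegral_indicM//.
    have [b' [c [[Gb' b'01 hb'] [Gc c01 hc bc]]]] := cond_indep_pair ij mB mC.
    set k := X j @^-1` C.
    have mc := measurable_wrt_measurable hG Gc.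
    have mb' := measurable_wrt_measurable hG Gb'.
    have mk : measurable_fun setT (\1_k : Omega -> R) by exact: measurable_indic.
    have k01 w : 0 <= (\1_k w : R) <= 1.
      by rewrite indicE ler0n lern1; case: (_ \in _).
    have L1b (V : Omega -> R) : measurable_fun setT V -> (forall w, 0 <= V w <= 1) -> L1 P V.
      move=> mV V01; apply: L1_le (L1_cst P 1) => // w.
      by have /andP[V0 V1] := V01 w; rewrite ger0_norm.
    have L1p (V V' : Omega -> R) : measurable_fun setT V -> (forall w, 0 <= V w <= 1) ->
        measurable_fun setT V' -> (forall w, 0 <= V' w <= 1) ->
        L1 P (fun w => V w * V' w).
      by move=> mV V01 mV' V'01; apply: L1_bounded_mul => //; exact: L1b.
    have L1pB (V V' V'' : Omega -> R) : measurable_fun setT V -> (forall w, 0 <= V w <= 1) ->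
        measurable_fun setT V' -> (forall w, 0 <= V' w <= 1) ->
        measurable_fun setT V'' -> (forall w, 0 <= V'' w <= 1) ->
        L1 P (fun w => V w * (V' w - V'' w)).
      by move=> *; apply: L1_bounded_mul => //; apply: L1B; exact: L1b.
    have kc1 : L1 P (fun w => \1_k w - c w) by apply: L1B; exact: L1b.
    have eb'1 : L1 P (fun w => \1_e w - b' w) by apply: L1B; exact: L1b.
    have e1 := Rintegral_sub_sigma_eq0 hG kc1 hc Gb (L1pB _ _ _ mb b01 mk k01 mc c01).
    have e2 := Rintegral_sub_sigma_eq0 hG eb1 hb Gc (L1pB _ _ _ mc c01 me e01 mb b01).
    have e3 := Rintegral_sub_sigma_eq0 hG eb'1 hb' Gc (L1pB _ _ _ mc c01 me e01 mb' b'01).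
    (* The version [b] was fixed before [C], while the product formula holds for the pair [b'], [c].
       The first difference vanishes by that formula; each other term is a centered indicator times
       a [G]-measurable factor, and multiplying by [c] passes from [b'] to [b]. *)
    transitivity (\int[P]_w (((\1_e w * \1_k w - b' w * c w)
        - c w * (\1_e w - b' w))
        + (c w * (\1_e w - b w) - b w * (\1_k w - c w)))).
      by apply: eq_Rintegral => w _; ring.
    have ek1 := L1p _ _ me e01 mk k01; have bc1 := L1p _ _ mb' b'01 mc c01.
    have c1 := L1pB _ _ _ mc c01 me e01 mb' b'01.
    have c2 := L1pB _ _ _ mc c01 me e01 mb b01.
    have c3 := L1pB _ _ _ mb b01 mk k01 mc c01.
    have d1 := L1B ek1 bc1.
    rewrite RintegralD//; [|exact: L1B|exact: L1B].
    by rewrite !RintegralB// e1 e2 e3 bc !subrr addr0.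
  transitivity (\int[P]_w ((h (X j w) * (\1_e w - b w) - Z w * (\1_e w - b w))
      + b w * (h (X j w) - Z w))).
    by apply: eq_Rintegral => w _; ring.
  have c1 := eb _ h1; have c2 := eb _ Z1.
  rewrite RintegralD//; last exact: L1B.
  by rewrite RintegralB// ebh ebZ bhZ subrr addr0.
have fW := L2_mul f2 hZ2; have YW := L2_mul Y2 hZ2.
transitivity (\int[P]_w (f (X i w) * (h (X j w) - Z w) - Y w * (h (X j w) - Z w))).
  by apply: eq_Rintegral => w _; rewrite mulrBl.
rewrite RintegralB// (@Rintegral_comp_mul_eq0 _ _ _ _ _ P (X i) (fun w => h (X j w) - Z w) f)//.
by rewrite (Rintegral_sub_sigma_eq0 hG hZ1 hZ GY)// subrr.
Qed.

End conditional_independence.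

(** * Compression noise *)

Section borel_vectors.
Context {R : realType} {d : nat}.
Local Notation V := (borelV R d).

Lemma continuous_borelV_measurable (f : 'rV[R]_d -> R) :
  continuous f -> measurable_fun setT (f : V -> R).
Proof.
move=> /continuousP cf; apply: (measurability _ (RGenOpens.measurableE R)).
move=> _ [_ [a [b ->] <-]]; rewrite setTI.
by apply: sub_gen_smallest; apply: cf; exact: interval_open.
Qed.

Lemma measurable_coord (j : 'I_d) :
  measurable_fun setT ((fun y : 'rV[R]_d => y 0 j) : V -> R).
Proof. by apply: continuous_borelV_measurable; exact: coord_continuous. Qed.

Lemma measurable_sqr_enormB (v : 'rV[R]_d) :
  measurable_fun setT ((fun y : 'rV[R]_d => enorm (y - v) ^+ 2) : V -> R).
Proof.
under eq_fun do rewrite enormE.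
apply: measurable_sum => j; apply: measurable_funX.
under eq_fun do rewrite !mxE.
by apply: measurable_funB => //; exact: measurable_coord.
Qed.

End borel_vectors.

Section compression.
Context {R : realType} {d : nat}.
Local Notation V := (borelV R d).
Variables (omega : R) (Q : R.-pker V ~> V).
Hypothesis Qc : unbiased_compressor omega Q.

(** Expand [|y|^2 = |y - v|^2 + 2 <v, y> - |v|^2]: the compressor bound makes the first term
    integrable with mean at most [omega |v|^2], and unbiasedness makes the rest average to
    [|v|^2]. *)
Lemma compressor_second_moment (v : 'rV[R]_d) :
  (\int[Q v]_y (enorm (y : 'rV[R]_d) ^+ 2)%:E
   <= ((1 + omega) * enorm v ^+ 2)%:E)%E.
Proof.
have [_ /(_ v) [Qv Qsq]] := Qc.
have e1 : L1 (Q v) (fun y : V => enorm ((y : 'rV[R]_d) - v) ^+ 2).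
  apply/integrableP; split.
    by apply/measurable_EFinP; exact: measurable_sqr_enormB.
  apply: le_lt_trans (ltry (omega * enorm v ^+ 2)).
  by under eq_integral do rewrite /= ger0_norm ?sqr_ge0//.
have c1 (a : R) : L1 (Q v) (fun=> a).
  apply/integrableP; split; first exact/measurable_EFinP.
  by rewrite (_ : (fun=> _) = cst (`|a|%:E)) // integral_cst// prob_kernel mule1 ltry.
have l1 : L1 (Q v) (fun y : V => \sum_(j < d) 2 * v 0 j * (y : 'rV[R]_d) 0 j).
  by apply: L1_sum => j; apply: L1Z; have [] := Qv j.
have s1 := L1B l1 (c1 (dot v v)).
have -> : (\int[Q v]_y (enorm (y : 'rV[R]_d) ^+ 2)%:E =
   \int[Q v]_y ((enorm ((y : 'rV[R]_d) - v) ^+ 2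
      + (\sum_(j < d) 2 * v 0 j * (y : 'rV[R]_d) 0 j - dot v v)))%:E)%E.
  apply: eq_integral => y _; congr EFin.
  have -> : \sum_(j < d) 2 * v 0 j * (y : 'rV[R]_d) 0 j = 2 * dot v y.
    by rewrite mulr_sumr; apply: eq_bigr => j _; rewrite mulrA.
  rewrite !sqr_enorm !dotE (dotC y v); ring.
rewrite integralD_EFin// mulrDl mul1r addrC EFinD; apply: leeD => //.
have lsum : \int[Q v]_y (\sum_(j < d) 2 * v 0 j * (y : 'rV[R]_d) 0 j)
    = \sum_(j < d) \int[Q v]_y (2 * v 0 j * (y : 'rV[R]_d) 0 j).
  rewrite (Rintegral_sum (P := Q v) _ (h := fun j (y : V) => 2 * v 0 j * (y : 'rV[R]_d) 0 j))// => j.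
  by apply: L1Z; have [] := Qv j.
rewrite integral_EFin// RintegralB ?lsum//; last exact: c1.
rewrite Rintegral_cst// prob_kernel mulr1 lee_fin sqr_enorm lerBlDr.
have -> : dot v v + dot v v = \sum_(j < d) 2 * v 0 j * v 0 j.
  by rewrite -big_split; apply: eq_bigr => j _ /=; ring.
apply: ler_sum => j _.
have [Qj1 Qj] := Qv j.
by rewrite RintegralZl// /Rintegral Qj.
Qed.

Context {dO : measure_display} {Omega : measurableType dO}.
Variables (P : probability Omega R) (G : set (set Omega)).
Hypothesis hG : sub_sigma_algebra G.
Variables g q : Omega -> 'rV[R]_d.
Hypotheses (mq : measurable_fun setT (q : Omega -> V))
  (qlaw : forall B : set V, measurable B ->
     is_cond_prob P G (q @^-1` B) (fun w => Q (g w) B)).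

Let mQg (B : set V) : measurable B -> measurable_fun setT (fun w => Q (g w) B).
Proof. by move=> /qlaw[_ _ GQ _]; exact: measurable_wrt_measurable GQ. Qed.

(** For indicators this is [qlaw]; both sides are integral-like in [f]. *)
Lemma integral_compress (A : set Omega) (f : V -> \bar R) : G A -> nnmeasurable f ->
  (\int[P]_(w in A) f (q w) = \int[P]_(w in A) \int[Q (g w)]_y f y)%E.
Proof.
move=> GA nnf; have mA := sub_sigma_measurable hG GA.
have mpre (B : set V) : measurable B -> measurable (q @^-1` B).
  by move=> mB; rewrite -[_ @^-1` _]setTI; exact: mq.
transitivity (\int[P]_w (f (q w) * (\1_A w)%:E))%E.
  by rewrite integral_mkcond epatch_indic.
apply: (@eq_integral_like _ V R (fun f => \int[P]_w (f (q w) * (\1_A w)%:E))%E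
  (fun f => \int[P]_(w in A) \int[Q (g w)]_y f y)%E f) => //.
- by apply: integral_like_density => // w; rewrite indicE ler0n.
- apply: integral_like_kernel => // B mB; exact: mQg.
move=> B mB.
transitivity (\int[P]_(w in A) (\1_(q @^-1` B) w)%:E)%E.
  by rewrite [RHS]integral_mkcond epatch_indic.
have [_ _ _ h] := qlaw mB; rewrite -h//; apply: eq_integral => w _.
by rewrite integral_indic// setIT.
Qed.

Hypothesis g2 : forall j, L2 P (fun w => g w 0 j).

Lemma L2_compress : (forall j, L2 P (fun w => q w 0 j)) /\
  \sum_(i < d) \int[P]_w (q w 0 i ^+ 2)
  <= (1 + omega) * \sum_(i < d) \int[P]_w (g w 0 i ^+ 2).
Proof.
have nn : nnmeasurable (fun y : V => (enorm (y : 'rV[R]_d) ^+ 2)%:E).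
  split=> [|y]; last by rewrite lee_fin sqr_ge0.
  apply/measurable_EFinP; have := @measurable_sqr_enormB R d 0.
  by under eq_fun do rewrite subr0.
have mqj i : measurable_fun setT (fun w => q w 0 i).
  exact: (measurableT_comp (@measurable_coord R d i) mq).
have g1 : L1 P (fun w => (1 + omega) * enorm (g w) ^+ 2).
  apply: L1Z; under eq_fun do rewrite enormE.
  by apply: L1_sum => i; have [] := g2 i.
have mk : measurable_fun setT (fun w => (\int[Q (g w)]_y (enorm (y : 'rV[R]_d) ^+ 2)%:E)%E).
  have [m0 n0] := nn.
  apply: (measurable_fun_integral_kernel (l := fun w => Q (g w))) => // B mB; exact: mQg.
have le : (\int[P]_w (enorm (q w) ^+ 2)%:E
           <= \int[P]_w ((1 + omega) * enorm (g w) ^+ 2)%:E)%E.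
  rewrite (integral_compress (sub_sigma_setT hG) nn).
  apply: ge0_le_integral => //.
  - by move=> w _; apply: integral_ge0 => y _; have [_] := nn; exact.
  - by apply/measurable_EFinP; exact: L1_measurable g1.
  - by move=> w _; exact: compressor_second_moment.
have q1 : L1 P (fun w => enorm (q w) ^+ 2).
  apply/integrableP; split.
    apply/measurable_EFinP; under eq_fun do rewrite enormE.
    by apply: measurable_sum => i; exact: measurable_funX.
  under eq_integral do rewrite /= ger0_norm ?sqr_ge0//.
  by apply: le_lt_trans le _; rewrite integral_EFin// ltry.
have q2 i : L2 P (fun w => q w 0 i).
  by apply: L2_le q1 => // w; exact: sqr_coord_le.
split=> //; move: le; rewrite !integral_EFin// lee_fin.
under eq_Rintegral do rewrite enormE.
rewrite Rintegral_sum => [|i]; last by have [] := q2 i.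
move=> h; apply: le_trans h _; rewrite RintegralZl//; last first.
  by under eq_fun do rewrite enormE; apply: L1_sum => i; have [] := g2 i.
under [in leLHS]eq_Rintegral do rewrite enormE.
by rewrite Rintegral_sum// => i; have [] := g2 i.
Qed.

Lemma compress_unbiased (j : 'I_d) (A : set Omega) : G A ->
  \int[P]_(w in A) (q w 0 j - g w 0 j) = 0.
Proof.
move=> GA; have mA := sub_sigma_measurable hG GA.
have [q2 _] := L2_compress.
have q1 : P.-integrable A (EFin \o (fun w => q w 0 j)).
  exact: integrableS (L2_L1 (q2 j)).
have g1 : P.-integrable A (EFin \o (fun w => g w 0 j)).
  exact: integrableS (L2_L1 (g2 j)).
rewrite RintegralB//; apply/eqP; rewrite subr_eq0; apply/eqP; congr fine.
(* Since [integral_compress] covers nonnegative functions, the coordinate is cut into positive and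
   negative parts. They are recombined at the end under [Q (g w)], whose mean is [g w]. *)
pose f := (EFin \o (fun y : 'rV[R]_d => y 0 j)) : V -> \bar R.
have mf : measurable_fun setT f by apply/measurable_EFinP; exact: measurable_coord.
have nnp : nnmeasurable f^\+%E.
  by split=> [|y]; [exact: measurable_funepos|exact: funepos_ge0].
have nnn : nnmeasurable f^\-%E.
  by split=> [|y]; [exact: measurable_funeneg|exact: funeneg_ge0].
have Kint (h : V -> \bar R) : nnmeasurable h -> (forall w, (h (q w) <= `|f (q w)|)%E) ->
    P.-integrable A (fun w => \int[Q (g w)]_y h y)%E.
  move=> nnh hf; have [mh h0] := nnh; apply/integrableP; split.
    apply: measurable_funTS.
    apply: (measurable_fun_integral_kernel (l := fun w => Q (g w))) => // B mB; exact: mQg.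
  under eq_integral do rewrite gee0_abs ?integral_ge0//.
  rewrite -(integral_compress GA nnh).
  have /integrableP[mqA] := q1; apply: le_lt_trans.
  apply: ge0_le_integral => //.
  - by apply: measurable_funTS; exact: (measurableT_comp mh mq).
  - exact: measurableT_comp.
rewrite integralE.
have -> : (\int[P]_(w in A) (fun w => (q w 0 j)%:E)^\+ w
   = \int[P]_(w in A) \int[Q (g w)]_y f^\+ y)%E.
  by rewrite -(integral_compress GA nnp); apply: eq_integral => w _; rewrite !funeposE.
have -> : (\int[P]_(w in A) (fun w => (q w 0 j)%:E)^\- w
   = \int[P]_(w in A) \int[Q (g w)]_y f^\- y)%E.
  by rewrite -(integral_compress GA nnn); apply: eq_integral => w _; rewrite !funenegE.
rewrite -integralB//.
- apply: eq_integral => w _ /=; rewrite -integralE.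
  by have [_ /(_ (g w)) [/(_ j) [_]]] := Qc.
- by apply: Kint => // w; rewrite funeposE ge_max lee_abs abse_ge0.
- by apply: Kint => // w; rewrite funenegE ge_max -abseN lee_abs abse_ge0.
Qed.

(** The integrand depends on [g] too, whereas [integral_compress] treats functions of [q] alone.
    Instead, [q - g] is orthogonal to the [G]-measurable [g], so the mean of [|q|^2] splits, and
    that of [|g|^2] is subtracted from the second-moment bound. *)
Lemma compress_variance : measurable_wrt G (g : Omega -> V) ->
  \sum_(j < d) \int[P]_w ((q w 0 j - g w 0 j) ^+ 2)
  <= omega * \sum_(j < d) \int[P]_w (g w 0 j ^+ 2).
Proof.
move=> Gg; have [q2 le] := L2_compress.
have qg2 j := L2B (q2 j) (g2 j).
have e (j : 'I_d) : \int[P]_w (q w 0 j ^+ 2) =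
    \int[P]_w ((q w 0 j - g w 0 j) ^+ 2) + \int[P]_w (g w 0 j ^+ 2).
  rewrite -Rintegral_sqrD//.
    by apply: eq_Rintegral => w _; rewrite subrK.
  under eq_Rintegral do rewrite mulrC.
  apply: (Rintegral_sub_sigma_eq0 hG (L2_L1 (qg2 j))); last exact: L2_mul.
    by move=> A; exact: compress_unbiased.
  apply/(measurable_wrtP hG).
  by apply: (measurableT_comp (@measurable_coord R d j)); exact/(measurable_wrtP hG).
move: le; under eq_bigr do rewrite e.
by rewrite big_split/= mulrDl mul1r addrC lerD2l.
Qed.

End compression.

(** * Noise of one iteration: [G] is the past, [G'] the past with the estimates *)

Section compressed_noise.
Context {R : realType} {d n : nat} {dO : measure_display} {Omega : measurableType dO}.
Local Notation V := (borelV R d).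

Lemma cond_exp_le_integral (P : probability Omega R) (G : set (set Omega))
    (X : Omega -> R) (c : R) : sub_sigma_algebra G -> 0 <= c ->
  cond_exp_le P G (EFin \o X) c -> (\int[P]_w (X w)%:E <= c%:E)%E.
Proof.
move=> hG c0 [Y [_ _ GY hY] Yc]; have mY := measurable_wrt_measurable hG GY.
rewrite -hY; last exact: sub_sigma_setT.
(* The version [Y] is known neither to be nonnegative nor integrable, so its negative part is
   dropped. *)
rewrite integralE; apply: (@le_trans _ _ (\int[P]_w Y^\+ w)%E).
  by rewrite geeDl// oppe_le0 integral_ge0// => w _; exact: funeneg_ge0.
apply: (@le_trans _ _ (\int[P]_w (cst c%:E w))%E); last first.
  rewrite integral_cst// -[leRHS]mule1; apply: lee_wpmul2l; first by rewrite lee_fin.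
  exact: probability_le1.
apply: ae_ge0_le_integral => //.
- exact: measurable_funepos.
- by apply: filterS Yc => w Yw _; rewrite funeposE ge_max Yw lee_fin.
Qed.

Variables (P : probability Omega R) (omega : R) (Q : R.-pker V ~> V)
  (G G' : set (set Omega)) (f g q : 'I_n -> Omega -> 'rV[R]_d)
  (sigma : 'I_n -> R).
Hypotheses (Qc : unbiased_compressor omega Q)
  (hG : sub_sigma_algebra G) (hG' : sub_sigma_algebra G') (GG' : G `<=` G')
  (f2 : forall i j, L2 P (fun w => f i w 0 j))
  (gG' : forall i, measurable_wrt G' (g i : Omega -> V))
  (mq : forall i, measurable_fun setT (q i : Omega -> V))
  (g_unbiased : forall i (j : 'I_d),
    is_cond_exp P G (fun w => (g i w 0 j)%:E) (fun w => (f i w 0 j)%:E))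
  (g_variance : forall i, cond_exp_le P G
    (fun w => (enorm (g i w - f i w) ^+ 2)%:E) (sigma i ^+ 2))
  (g_indep : cond_indep P G (g : 'I_n -> Omega -> V))
  (q_law : forall i (B : set V), measurable B ->
     is_cond_prob P G' (q i @^-1` B) (fun w => Q (g i w) B))
  (q_indep : cond_indep P G' (q : 'I_n -> Omega -> V)).

Let mg i : measurable_fun setT (g i : Omega -> V).
Proof. apply: measurable_wrt_measurable; [exact: hG'|exact: gG']. Qed.

Lemma measurable_wrt_coord (H : set (set Omega)) (y : Omega -> 'rV[R]_d) (j : 'I_d) :
  sub_sigma_algebra H -> measurable_wrt H (y : Omega -> V) ->
  measurable_wrt H (fun w => y w 0 j).
Proof.
move=> hH /(measurable_wrtP hH) my; apply/(measurable_wrtP hH).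
exact: (measurableT_comp (@measurable_coord R d j) my).
Qed.

Let Gf i j : measurable_wrt G (fun w => f i w 0 j).
Proof.
have [_ _ /(measurable_wrtP hG) mf _] := g_unbiased i j.
by apply/(measurable_wrtP hG)/measurable_EFinP.
Qed.

Let v i j w : R := g i w 0 j - f i w 0 j.
Let u i j w : R := q i w 0 j - g i w 0 j.

Let noise_L1 i : L1 P (fun w => enorm (g i w - f i w) ^+ 2).
Proof.
have le := cond_exp_le_integral hG (sqr_ge0 (sigma i)) (g_variance i).
have [Y [/measurable_EFinP m _ _ _] _] := g_variance i.
apply/integrableP; split; first exact/measurable_EFinP.
under eq_integral do rewrite /= ger0_norm ?sqr_ge0//.
exact: le_lt_trans le (ltry _).
Qed.

Let v2 i j : L2 P (v i j).
Proof.
apply: L2_le (noise_L1 i) => [|w].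
  apply: measurable_funB; last by have [] := f2 i j.
  exact: (measurableT_comp (@measurable_coord R d j) (mg i)).
by have := sqr_coord_le (g i w - f i w) j; rewrite !mxE.
Qed.

Let g2 i j : L2 P (fun w => g i w 0 j).
Proof.
by have := L2D (v2 i j) (f2 i j); under eq_fun do rewrite subrK.
Qed.

Let q2 i j : L2 P (fun w => q i w 0 j).
Proof. by have [+ _] := L2_compress Qc hG' (mq i) (q_law i) (g2 i); exact. Qed.

Let u2 i j : L2 P (u i j). Proof. exact: L2B. Qed.

Let hu i j A : G' A -> \int[P]_(w in A) u i j w = 0.
Proof. exact: (compress_unbiased Qc hG' (mq i) (q_law i) (g2 i)). Qed.

Let hv i j A : G A -> \int[P]_(w in A) v i j w = 0.
Proof.
move=> GA; have mA := sub_sigma_measurable hG GA.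
have [_ _ _ /(_ _ GA) h] := g_unbiased i j.
rewrite RintegralB//; [|exact: integrableS (L2_L1 (g2 i j))
                        |exact: integrableS (L2_L1 (f2 i j))].
by apply/eqP; rewrite subr_eq0; apply/eqP; congr fine.
Qed.

Let wrtG' (phi : Omega -> R) : measurable_wrt G phi -> measurable_wrt G' phi.
Proof. by move=> h B mB; apply: GG'; exact: h. Qed.

Let Gg i j : measurable_wrt G' (fun w => g i w 0 j).
Proof. exact: measurable_wrt_coord. Qed.

Let phi_u phi i j : L2 P phi -> measurable_wrt G' phi ->
  \int[P]_w (phi w * u i j w) = 0.
Proof.
move=> phi2 Gphi; apply: (Rintegral_sub_sigma_eq0 hG') => //.
- exact: L2_L1.
- exact: hu.
- exact: L2_mul.
Qed.

Let phi_v phi i j : L2 P phi -> measurable_wrt G phi ->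
  \int[P]_w (phi w * v i j w) = 0.
Proof.
move=> phi2 Gphi; apply: (Rintegral_sub_sigma_eq0 hG) => //.
- exact: L2_L1.
- exact: hv.
- exact: L2_mul.
Qed.

(** Holds also for [i = l]: [v l j] is known given [G'], while [u i j] is centered given [G']. *)
Let vu i l j : \int[P]_w (v l j w * u i j w) = 0.
Proof. by apply: phi_u => //; apply: measurable_wrtB => //; exact: wrtG'. Qed.

Let vv i l j : i != l -> \int[P]_w (v i j w * v l j w) = 0.
Proof.
move=> il.
apply: (cond_indep_orthogonal hG mg g_indep il (@measurable_coord R d j)
  (@measurable_coord R d j)) => //; first [exact: g2 | exact: hv].
Qed.

(** Same argument as [vv], one level up: given [G'] the estimates are known and serve as the centers
    of the [q i], as the [f i] do for the [g i] given [G]. *)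
Let uu i l j : i != l -> \int[P]_w (u i j w * u l j w) = 0.
Proof.
move=> il.
apply: (cond_indep_orthogonal hG' mq q_indep il (@measurable_coord R d j)
  (@measurable_coord R d j)) => //; first [exact: q2 | exact: hu].
Qed.

Let t i j w := u i j w + v i j w.

Let t2 i j : L2 P (t i j). Proof. exact: L2D. Qed.

Let tt i l j : i != l -> \int[P]_w (t i j w * t l j w) = 0.
Proof.
move=> il.
transitivity (\int[P]_w ((u i j w * u l j w + v l j w * u i j w)
   + (v i j w * u l j w + v i j w * v l j w))).
  by apply: eq_Rintegral => w _; rewrite /t; ring.
have h1 := L2_mul (u2 i j) (u2 l j); have h2 := L2_mul (v2 l j) (u2 i j).
have h3 := L2_mul (v2 i j) (u2 l j); have h4 := L2_mul (v2 i j) (v2 l j).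
rewrite RintegralD//; [|exact: L1D|exact: L1D].
by rewrite !RintegralD// uu// vv// !vu !addr0.
Qed.

Let E2 i j : \int[P]_w (t i j w ^+ 2)
  = \int[P]_w (u i j w ^+ 2) + \int[P]_w (v i j w ^+ 2).
Proof.
rewrite Rintegral_sqrD//; under eq_Rintegral do rewrite mulrC; exact: vu.
Qed.

Let e j w : R := (mean_vec (q ^~ w) - mean_vec (f ^~ w)) 0 j.

Let eE j w : e j w = n%:R^-1 * \sum_(i < n) t i j w.
Proof.
rewrite /e /mean_vec !mxE -mulrBr !summxE -sumrB; congr (_ * _).
by apply: eq_bigr => i _; rewrite /t /u /v addrA subrK.
Qed.

Lemma noise_L2 j : L2 P (e j).
Proof. by rewrite (funext (eE j)); apply: L2Z; exact: L2_sum. Qed.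

Lemma noise_centered phi j : L2 P phi -> measurable_wrt G phi ->
  \int[P]_w (phi w * e j w) = 0.
Proof.
move=> phi2 Gphi.
transitivity (\int[P]_w (n%:R^-1 * \sum_(i < n) (phi w * u i j w + phi w * v i j w))).
  apply: eq_Rintegral => w _; rewrite eE mulrCA mulr_sumr; congr (_ * _).
  by apply: eq_bigr => i _; rewrite mulrDr.
have pu i := L2_mul phi2 (u2 i j); have pv i := L2_mul phi2 (v2 i j).
rewrite RintegralZl//; last by apply: L1_sum => i; exact: L1D.
rewrite Rintegral_sum => [|i]; last exact: L1D.
rewrite big1 ?mulr0// => i _.
rewrite RintegralD//; [|exact: pu|exact: pv].
by rewrite phi_u ?phi_v ?addr0//; exact: wrtG'.
Qed.

(** Orthogonality leaves, for each [i], the compression error, at most [omega] times the mean of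
    [|g i|^2], and the sampling error, at most [sigma i ^+ 2]. The mean of [|g i|^2] splits again
    around [f i], whence the factor [1 + omega]. *)
Lemma noise_variance : \sum_(j < d) \int[P]_w (e j w ^+ 2)
  <= n%:R ^- 2 * \sum_(i < n) (omega * \sum_(j < d) \int[P]_w (f i w 0 j ^+ 2)
                             + (1 + omega) * sigma i ^+ 2).
Proof.
have -> : \sum_(j < d) \int[P]_w (e j w ^+ 2) = n%:R ^- 2 * \sum_(i < n)
   (\sum_(j < d) \int[P]_w (u i j w ^+ 2) + \sum_(j < d) \int[P]_w (v i j w ^+ 2)).
  under [in RHS]eq_bigr do rewrite -big_split/=.
  rewrite exchange_big/= mulr_sumr; apply: eq_bigr => j _.
  under eq_Rintegral do rewrite eE exprMn exprVn.
  have [_ h] := L2_sum (index_enum _) (fun i => t2 i j).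
  rewrite RintegralZl// Rintegral_sqr_sum//; last by move=> *; exact: tt.
  by congr (_ * _); apply: eq_bigr => i _; exact: E2.
apply: ler_wpM2l; first by rewrite invr_ge0 exprn_ge0.
apply: ler_sum => i _; have [omega0 _] := Qc.
have vle : \sum_(j < d) \int[P]_w (v i j w ^+ 2) <= sigma i ^+ 2.
  have := cond_exp_le_integral hG (sqr_ge0 (sigma i)) (g_variance i).
  rewrite integral_EFin// lee_fin; apply: le_trans.
  under [leRHS]eq_Rintegral do rewrite enormE.
  rewrite -Rintegral_sum => [|j]; last by have [] := v2 i j.
  rewrite le_eqVlt; apply/orP; left; apply/eqP; apply: eq_Rintegral => w _.
  by apply: eq_bigr => j _; rewrite !mxE.
have ule := compress_variance Qc hG' (mq i) (q_law i) (g2 i) (gG' i).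
have gE j : \int[P]_w (g i w 0 j ^+ 2)
    = \int[P]_w (f i w 0 j ^+ 2) + \int[P]_w (v i j w ^+ 2).
  rewrite -Rintegral_sqrD//; last exact: phi_v.
  by apply: eq_Rintegral => w _; rewrite addrC subrK.
move: ule; rewrite (eq_bigr _ (fun j _ => gE j)).
rewrite big_split/= mulrDr => ule.
have := ler_wpM2l omega0 vle; move: vle ule; rewrite -/(u i).
lra.
Qed.

End compressed_noise.

(** * The recursion in expectation *)

Theorem theoremG2 (R : realType) (dO : measure_display)
  (Omega : measurableType dO) (P : probability Omega R) (d n : nat)
  (n_gt0 : (0 < n)%N)
  (F_ : 'I_n -> 'rV[R]_d -> 'rV[R]_d)
  (Reg : 'rV[R]_d -> \bar R)
  (Reg_proper : proper Reg)
  (Reg_lsc : lower_semicontinuous Reg)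
  (Reg_convex : convex Reg)
  (Xstar : set 'rV[R]_d)
  (XstarE : Xstar = vi_solutions (mean_op F_) Reg)
  (Xstar_neq0 : Xstar !=set0)
  (proj : 'rV[R]_d -> 'rV[R]_d)
  (projP : is_projection Xstar proj)
  (zeta_finite : has_ubound (sq_norms_at F_ Xstar))
  (mu l lhat omega gamma : R) (sigma : 'I_n -> R)
  (mu_gt0 : 0 < mu)
  (F_qsm : quasi_strongly_monotone proj (mean_op F_) mu)
  (F_coco : star_cocoercive proj (mean_op F_) l)
  (lhat_gt0 : 0 < lhat)
  (F_lhat : forall x : 'rV[R]_d,
     n%:R^-1 * (\sum_(i < n) enorm (F_ i x - F_ i (proj x)) ^+ 2)
     <= lhat * dot (mean_op F_ x - mean_op F_ (proj x)) (x - proj x))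
  (Q : R.-pker (borelV R d) ~> (borelV R d))
  (Q_compressor : unbiased_compressor omega Q)
  (x0 : 'rV[R]_d)
  (hist : nat -> set (set Omega))
  (x : nat -> Omega -> 'rV[R]_d)
  (g q : nat -> 'I_n -> Omega -> 'rV[R]_d)
  (run : qsgda_run P Reg Q gamma x0 hist x g q)
  (g_unbiased : unbiased_estimates P hist x g F_)
  (g_variance : bounded_variance P hist x g F_ sigma)
  (gamma_gt0 : 0 < gamma)
  (gamma_le : gamma <= 1 / (3 * l + 9 * omega * lhat / n%:R)) :
  forall k : nat,
    ('E_P[fun w => (enorm (x k w - proj (x k w)) ^+ 2)%R]
     <= ((1 - gamma * mu) ^+ k * enorm (x0 - proj x0) ^+ 2
         + gamma * ((3 * (1 + 3 * omega) * mean_sq sigma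
                     + 9 * omega * zeta_star_sq F_ Xstar)
                    / (n%:R * mu)))%:E)%E.
Proof.
have [omega_ge0 _] := Q_compressor; subst Xstar.
set Xs := vi_solutions (mean_op F_) Reg in projP zeta_finite *.
have nR_gt0 : 0 < n%:R :> R by rewrite ltr0n.
set zeta := zeta_star_sq F_ Xs.
have zeta_ge0 : 0 <= zeta by exact: zeta_star_sq_ge0 projP zeta_finite.
have sigma_ge0 : 0 <= mean_sq sigma.
  rewrite mulr_ge0 ?invr_ge0 ?ler0n//.
  by apply: sumr_ge0 => i _; exact: sqr_ge0.
have PT : fine (P setT) = 1 by rewrite (_ : P setT = 1%E)//; exact: probability_setT.
pose D k w := enorm (x k w - proj (x k w)) ^+ 2.
have D_ge0 k w : 0 <= D k w by exact: sqr_ge0.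
have hG' k : sub_sigma_algebra (hist_est hist g k).
  split; first exact: smallest_sigma_algebra.
  apply: smallest_sub; first exact: sigma_algebra_measurable.
  move=> A [/(proj2 (run_hist run k))//|[i _ [B mB <-]]].
  apply: (measurable_wrt_measurable (run_hist run k.+1) (run_hist_g run k i)) => //.
(* Continuity of [proj] enters here: it makes [x k - proj (x k)] an admissible multiplier in
   [noise_centered]. *)
have aG k j : measurable_wrt (hist k) (fun w => x k w 0 j - proj (x k w) 0 j).
  have [hk xk] := (run_hist run k, run_hist_x run k).
  apply: measurable_wrtB => //; first exact: measurable_wrt_coord.
  apply/(measurable_wrtP hk).
  have mpj : measurable_fun setT ((fun y => proj y 0 j) : borelV R d -> R).
    apply: continuous_borelV_measurable => y.
    apply: (@continuous_comp _ _ _ proj (fun z : 'rV[R]_d => z 0 j)).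
      exact: continuous_proj projP y.
    exact: coord_continuous.
  by apply: (measurableT_comp mpj); exact/(measurable_wrtP hk).
have aM k j : measurable_fun setT (fun w => x k w 0 j - proj (x k w) 0 j).
  by have := measurable_wrt_measurable (run_hist run k) (aG k j).
have DE k w : D k w = \sum_(j < d) (x k w 0 j - proj (x k w) 0 j) ^+ 2.
  by rewrite /D enormE; apply: eq_bigr => j _; rewrite !mxE.
have mD k : measurable_fun setT (D k).
  rewrite (funext (DE k)); apply: measurable_sum => j; apply: measurable_funX.
  exact: aM.
(* [gamma ^+ 2 * C] collects the sampling part of [2 * gamma ^+ 2] times the noise variance and the
   [zeta] term of [descent_step]. *)
pose C := (2 * (1 + omega) * mean_sq sigma + 4 * omega * zeta) / n%:R.
have step k : L1 P (D k) -> L1 P (D k.+1) /\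
    \int[P]_w D k.+1 w <= (1 - gamma * mu) * \int[P]_w D k w + gamma ^+ 2 * C.
  move=> Dk1.
  pose f i w := F_ i (x k w).
  have fle i w : enorm (f i w) ^+ 2 <= 2 * n%:R * (lhat * (l * D k w) + zeta).
    apply: le_trans (sum_sqr_le_dist n_gt0 projP zeta_finite mu_gt0 F_qsm F_coco
      lhat_gt0 F_lhat (x k w)).
    rewrite (bigD1 i)//= lerDl; apply: sumr_ge0 => h _; exact: sqr_ge0.
  have f2 i j : L2 P (fun w => f i w 0 j).
    apply: (@L2_le _ _ _ _ _ (fun w => 2 * n%:R * (lhat * (l * D k w) + zeta))).
    (* Measurability of [F_ i] along the iterates comes from its being a version of the conditional
       expectation of [g k i]. *)
    - have [_ _ fG _] := g_unbiased k i j.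
      apply/measurable_EFinP.
      by have := measurable_wrt_measurable (run_hist run k) fG.
    - by move=> w; exact: le_trans (sqr_coord_le _ _) (fle i w).
    - by apply: L1Z; apply: L1D; [do 2 apply: L1Z|exact: L1_cst].
  pose a j w := x k w 0 j - proj (x k w) 0 j.
  pose e j w := (mean_vec (q k ^~ w) - mean_vec (f ^~ w)) 0 j.
  have a2 j : L2 P (a j).
    apply: (@L2_le _ _ _ _ (a j) _ _ _ Dk1) => [|w].
      exact: aM.
    by have := sqr_coord_le (x k w - proj (x k w)) j; rewrite !mxE.
  have GG' : hist k `<=` hist_est hist g k.
    by move=> A hA; apply: sub_gen_smallest; left.
  have gG' i : measurable_wrt (hist_est hist g k) (g k i : Omega -> borelV R d).
    move=> B mB; apply: sub_gen_smallest; right; exists i => //.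
    by exists B => //; rewrite setTI.
  have mq i : measurable_fun setT (q k i : Omega -> borelV R d).
    by have := measurable_wrt_measurable (run_hist run k.+1) (run_hist_q run k i).
  have e2 j : L2 P (e j).
    exact: (noise_L2 Q_compressor (run_hist run k) (hG' k) f2 gG' mq (g_variance k)
      (run_q_law run k)).
  have ae0 j : \int[P]_w (a j w * e j w) = 0.
    exact: (noise_centered Q_compressor (run_hist run k) (hG' k) GG' f2 gG' mq
      (g_unbiased k) (g_variance k) (run_q_law run k) j (a2 j) (aG k j)).
  have ev := noise_variance Q_compressor (run_hist run k) (hG' k) GG' f2 gG' mq
      (g_unbiased k) (g_variance k) (run_g_indep run k) (run_q_law run k)
      (run_q_indep run k).
  (* The factor of the sum of the [|F_i x|^2] in [2 * gamma ^+ 2] times the variance bound; this is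
     what lets the integral of [c * S] cancel. *)
  pose c := 2 * gamma ^+ 2 * omega / n%:R ^+ 2.
  pose K := 4 * gamma ^+ 2 * omega * zeta / n%:R.
  pose S w := \sum_(i < n) \sum_(j < d) f i w 0 j ^+ 2.
  pose ub w := ((1 - gamma * mu) * D k w + K)
     + (2 * gamma ^+ 2 * (\sum_(j < d) e j w ^+ 2)
        - 2 * gamma * (\sum_(j < d) a j w * e j w)).
  have c_ge0 : 0 <= c.
    by rewrite divr_ge0 ?sqr_ge0// mulr_ge0// mulr_ge0 ?sqr_ge0.
  have S_ge0 w : 0 <= S w.
    by do 2 (apply: sumr_ge0 => ? _); exact: sqr_ge0.
  have descent w : D k.+1 w + c * S w <= ub w.
    have pw : prox gamma Reg (x k w - gamma *: mean_vec (fun i => q k i w)) (x k.+1 w).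
      by rewrite (run_step run).
    have := descent_step n_gt0 Reg_proper Reg_convex projP zeta_finite mu_gt0 omega_ge0
      F_qsm F_coco lhat_gt0 F_lhat gamma_gt0 gamma_le pw.
    have -> : \sum_(i < n) enorm (F_ i (x k w)) ^+ 2 = S w.
      by apply: eq_bigr => i _; rewrite enormE.
    have -> : dot (x k w - proj (x k w))
        (mean_vec (fun i => q k i w) - mean_op F_ (x k w)) = \sum_(j < d) a j w * e j w.
      by apply: eq_bigr => j _; rewrite /a [X in X * _]mxE [X in _ + X]mxE.
    have -> : enorm (mean_vec (fun i => q k i w) - mean_op F_ (x k w)) ^+ 2
        = \sum_(j < d) e j w ^+ 2.
      exact: enormE.
    rewrite -/(D k w) -/(D k.+1 w) -/c -/K /ub; lra.
  have e1 : L1 P (fun w => \sum_(j < d) e j w ^+ 2).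
    by apply: L1_sum => j; have [] := e2 j.
  have ae1 : L1 P (fun w => \sum_(j < d) a j w * e j w).
    by apply: L1_sum => j; exact: L2_mul.
  have S1 : L1 P S.
    by apply: L1_sum => i; apply: L1_sum => j; have [] := f2 i j.
  have u1 := L1D (L1Z (1 - gamma * mu) Dk1) (L1_cst P K).
  have u2 := L1B (L1Z (2 * gamma ^+ 2) e1) (L1Z (2 * gamma) ae1).
  have ub1 : L1 P ub by exact: L1D.
  have Dk2 : L1 P (D k.+1).
    apply: L1_le ub1 => // w; rewrite ger0_norm//.
    by apply: le_trans (descent w); rewrite lerDl mulr_ge0.
  split=> //.
  have cS1 := L1Z c S1.
  have IE : \int[P]_w (\sum_(j < d) e j w ^+ 2) = \sum_(j < d) \int[P]_w (e j w ^+ 2).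
    by apply: Rintegral_sum => j; have [] := e2 j.
  have IA : \int[P]_w (\sum_(j < d) a j w * e j w) = 0.
    by rewrite Rintegral_sum ?big1// => j; exact: L2_mul.
  have IS : \int[P]_w S w = \sum_(i < n) \sum_(j < d) \int[P]_w (f i w 0 j ^+ 2).
    rewrite Rintegral_sum => [|i].
      by apply: eq_bigr => i _; rewrite Rintegral_sum// => j; have [] := f2 i j.
    by apply: L1_sum => j; have [] := f2 i j.
  have := le_Rintegral measurableT (L1D Dk2 cS1) ub1 (fun w _ => descent w).
  rewrite RintegralD// RintegralZl// [X in _ <= X]RintegralD//.
  rewrite RintegralB//; [|exact: L1Z|exact: L1Z].
  rewrite RintegralD//; [|exact: L1Z|exact: L1_cst].
  rewrite Rintegral_cst// PT mulr1 !RintegralZl//.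
  rewrite IE IA IS mulr0 subr0.
  move: ev; rewrite big_split/= -!mulr_sumr.
  move: (\sum_(i < n) \sum_(j < d) _) (\sum_(j < d) _) => SF SE.
  rewrite /C /mean_sq; move: (\sum_(i < n) _) => Ss ev h.
  have g2 : 0 <= 2 * gamma ^+ 2 by rewrite mulr_ge0 ?sqr_ge0.
  have {}ev := ler_wpM2l g2 ev.
  have E1 : 2 * gamma ^+ 2 * (n%:R ^- 2 * (omega * SF + (1 + omega) * Ss))
    = c * SF + (gamma ^+ 2 * ((2 * (1 + omega) * (n%:R^-1 * Ss) + 4 * omega * zeta)
                 / n%:R) - K).
    by rewrite /c /K; field; rewrite gt_eqF.
  rewrite E1 in ev; lra.
pose Cp := 3 * (1 + 3 * omega) * mean_sq sigma + 9 * omega * zeta.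
(* The claimed noise level is thus reproduced by one step of the recursion, and the induction closes
   without summing a geometric series. The comparison is [2 * (1 + omega) <= 3 * (1 + 3 * omega)]
   and [4 <= 9]. *)
have CCp : gamma ^+ 2 * C <= gamma * mu * (gamma * (Cp / (n%:R * mu))).
  have -> : gamma * mu * (gamma * (Cp / (n%:R * mu))) = gamma ^+ 2 * (Cp / n%:R).
    by field; rewrite !gt_eqF.
  rewrite ler_wpM2l ?sqr_ge0// ler_wpM2r ?invr_ge0 ?ler0n// /Cp.
  have := mulr_ge0 omega_ge0 sigma_ge0; have := mulr_ge0 omega_ge0 zeta_ge0; lra.
have Cp_ge0 : 0 <= gamma * (Cp / (n%:R * mu)).
  apply: mulr_ge0 (ltW gamma_gt0) (divr_ge0 _ (ltW (mulr_gt0 nR_gt0 mu_gt0))).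
  rewrite /Cp; have := mulr_ge0 omega_ge0 sigma_ge0.
  have := mulr_ge0 omega_ge0 zeta_ge0; lra.
have main k : L1 P (D k) /\ \int[P]_w D k w <=
    (1 - gamma * mu) ^+ k * enorm (x0 - proj x0) ^+ 2 + gamma * (Cp / (n%:R * mu)).
  elim: k => [|k [Dk1 ih]].
    have -> : D 0%N = fun=> enorm (x0 - proj x0) ^+ 2.
      by apply/funext => w; rewrite /D (run_init run).
    split; first exact: L1_cst.
    by rewrite Rintegral_cst// PT mulr1 expr0 mul1r lerDl.
  have [Dk2 le] := step k Dk1; split=> //.
  (* If every point is a solution, 1 - gamma * mu may be negative, but then all
     distances vanish. *)
  have [[y yp]|/forallNP all0] := pselect (exists y, y != proj y).
    have c0 := contraction_ge0 mu_gt0 omega_ge0 F_qsm F_coco lhat_gt0 gamma_gt0 gamma_le yp.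
    apply: le_trans le _; rewrite (exprS _ k) -(mulrA (1 - gamma * mu)).
    move: (ler_wpM2l c0 ih) CCp.
    move: (_ ^+ k * _) (gamma * (Cp / _)) (\int[P]_w D k w) (gamma ^+ 2 * C) => *; lra.
  have e0 y : enorm (y - proj y) ^+ 2 = 0.
    have /negP/negPn/eqP <- := all0 y.
    by rewrite subrr sqr_enorm dot0l.
  rewrite e0 mulr0 add0r.
  have -> : D k.+1 = fun=> 0 by apply/funext => w; exact: e0.
  by rewrite Rintegral_cst// mul0r.
move=> k; have [Dk1 le] := main k.
by rewrite unlock integral_EFin// lee_fin.
Qed.
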